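(* Let $X$ be a formal vector field on $\mathbb{C}^n$ vanishing at the origin, and assume $X$ is in Poincaré–Dulac normal form with diagonal semisimple part $X^s=\sum_{i=1}^n\gamma_i x_i\,\partial/\partial x_i$. Write $X^s=\sum_{k=1}^{\tau}\rho_k Z_k$ where $\tau$ is the toric degree, $\rho_1,\dots,\rho_\tau\in\mathbb{C}$ are incommensurable and $Z_k=\sum_{j=1}^n a_{kj}x_j\,\partial/\partial x_j$ with $a_{kj}\in\mathbb{Z}$. Let $\Lambda$ be a formal rational tensor field on $\mathbb{C}^n$. Then: (i) if $\mathcal{L}_X\Lambda=0$, then $\mathcal{L}_{Z_k}\Lambda=0$ for every $k=1,\dots,\tau$; (ii) if $\mathcal{L}_X\Lambda=g\Lambda$ for some formal function $g$, then for every $k=1,\dots,\tau$ there is a formal function $g_k$ with $\mathcal{L}_{Z_k}\Lambda=g_k\Lambda$.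
   Context: For a formal vector field $X$ vanishing at $0$, let $X^{(1)}=X^s+X^n$ be the Jordan decomposition of its linear part into semisimple and nilpotent parts; $X$ is in Poincaré–Dulac normal form if $[X^s,X]=0$. When $X^s=\sum\gamma_i x_i\partial/\partial x_i$ is diagonal, the toric degree $\tau$ is the smallest integer such that $X^s=\sum_{k=1}^\tau\rho_kZ_k$ with $\rho_k\in\mathbb{C}$ and $Z_k=\sum_j a_{kj}x_j\partial/\partial x_j$, $a_{kj}\in\mathbb{Z}$; minimality is equivalent to $\rho_1,\dots,\rho_\tau$ being incommensurable (linearly independent over $\mathbb{Q}$). The vector fields $\sqrt{-1}Z_k$ generate the associated torus action of $X$. A formal rational tensor field is a quotient $\Lambda=\Omega/f$ of a formal tensor field $\Omega$ by a nontrivial formal function $f$; Lie derivatives are computed by the quotient rule. *)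

(* Defs.v *)
From HB Require Import structures.
From mathcomp Require Import all_boot all_order all_algebra.
Set Implicit Arguments. Unset Strict Implicit. Unset Printing Implicit Defensive.
Import Order.TTheory GRing.Theory Num.Theory.
Local Open Scope ring_scope.

Definition mindex (n : nat) := 'I_n -> nat.
Definition fps (C : Type) (n : nat) := mindex n -> C.

Section FPS.
Variables (C : numClosedFieldType) (n : nat).
Implicit Types (f g : fps C n) (al : mindex n).

Definition fps0 : fps C n := fun _ => 0.
Definition fps1 : fps C n := fun al => if [forall j, al j == 0%N] then 1 else 0.
Definition fps_add f g : fps C n := fun al => f al + g al.
Definition fps_opp f : fps C n := fun al => - f al.
Definition fps_sub f g : fps C n := fun al => f al - g al.
Definition fps_mul f g : fps C n := fun al =>
  \sum_(b : {ffun 'I_n -> 'I_(\max_(i < n) al i).+1} | [forall i, (b i <= al i)%N])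
     f (fun i => nat_of_ord (b i)) * g (fun i => (al i - b i)%N).
Definition fps_lin (c : C) (i : 'I_n) : fps C n :=
  fun al => if [forall j, al j == (j == i) :> nat] then c else 0.
Definition mi_inc al (k : 'I_n) : mindex n :=
  fun i => if i == k then (al i).+1 else al i.
Definition fps_deriv (k : 'I_n) f : fps C n :=
  fun al => (al k).+1%:R * f (mi_inc al k).
Definition fps_nonzero f : Prop := exists al, f al != 0.
Definition fps_eq f g : Prop := forall al, f al = g al.

Definition vfield := 'I_n -> fps C n.
Definition vf_apply (X : vfield) f : fps C n :=
  fun al => \sum_(k < n) fps_mul (X k) (fps_deriv k f) al.
Definition vf_vanishes (X : vfield) : Prop := forall i, X i (fun _ => 0%N) = 0.
Definition vf_linpart (X : vfield) : 'M[C]_n :=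
  \matrix_(i, j) X i (fun l => nat_of_bool (l == j)).
Definition vf_bracket (Y X : vfield) : vfield :=
  fun i al => vf_apply Y (X i) al - vf_apply X (Y i) al.
Definition vf_eq0 (X : vfield) : Prop := forall i al, X i al = 0.
Definition diag_vf (c : 'I_n -> C) : vfield := fun i => fps_lin (c i) i.

(* formal (p,q)-tensor fields: components T^{I}_{J} *)
Definition tensor (p q : nat) := ('I_p -> 'I_n) -> ('I_q -> 'I_n) -> fps C n.
Definition upd (m : nat) (I : 'I_m -> 'I_n) (r : 'I_m) (k : 'I_n) : 'I_m -> 'I_n :=
  fun r' => if r' == r then k else I r'.
Definition lie (p q : nat) (X : vfield) (T : tensor p q) : tensor p q :=
  fun I J al =>
    vf_apply X (T I J) al
    - \sum_(r < p) \sum_(k < n) fps_mul (T (upd I r k) J) (fps_deriv k (X (I r))) al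
    + \sum_(s < q) \sum_(k < n) fps_mul (T I (upd J s k)) (fps_deriv (J s) (X k)) al.

(* formal rational tensor fields Omega / f, f nontrivial *)
Definition rtensor (p q : nat) := (tensor p q * fps C n)%type.
Definition rt_wf p q (L : rtensor p q) : Prop := fps_nonzero L.2.
Definition rt_eq p q (L1 L2 : rtensor p q) : Prop :=
  forall I J al, fps_mul L2.2 (L1.1 I J) al = fps_mul L1.2 (L2.1 I J) al.
Definition rt_zero p q : rtensor p q := (fun _ _ => fps0, fps1).
Definition rt_scale p q (g : fps C n) (L : rtensor p q) : rtensor p q :=
  (fun I J => fps_mul g (L.1 I J), L.2).
(* Lie derivative by the quotient rule: L_X(Omega/f) = (f L_X Omega - X(f) Omega)/f^2 *)
Definition rt_lie p q (X : vfield) (L : rtensor p q) : rtensor p q :=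
  (fun I J => fps_sub (fps_mul L.2 (lie X L.1 I J)) (fps_mul (vf_apply X L.2) (L.1 I J)),
   fps_mul L.2 L.2).
End FPS.

Definition toric_decomp {C : numClosedFieldType} {n t : nat} (gamma : 'I_n -> C)
  (rho : 'I_t -> C) (a : 'I_t -> 'I_n -> int) : Prop :=
  forall j, gamma j = \sum_(k < t) rho k * (a k j)%:~R.
Definition toric_degree {C : numClosedFieldType} {n : nat} (gamma : 'I_n -> C) (tau : nat) : Prop :=
  (exists rho a, @toric_decomp C n tau gamma rho a) /\
  forall t, (exists rho a, @toric_decomp C n t gamma rho a) -> (tau <= t)%N.
Definition incommensurable {C : numClosedFieldType} {t : nat} (rho : 'I_t -> C) : Prop :=
  forall q : 'I_t -> rat, \sum_(k < t) ratr (q k) * rho k = 0 -> forall k, q k = 0.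
Definition Zfield {C : numClosedFieldType} {n t : nat} (a : 'I_t -> 'I_n -> int) (k : 'I_t)
  : vfield C n := diag_vf (fun j => (a k j)%:~R).

(* Main.v *)
Require Import Defs.
From HB Require Import structures.
From mathcomp Require Import all_boot all_order all_algebra.
From mathcomp Require Import boolp.
From mathcomp Require Import zify ring.
Import Order.TTheory GRing.Theory Num.Theory.
Set Implicit Arguments. Unset Strict Implicit. Unset Printing Implicit Defensive.
Local Open Scope ring_scope.

(** In finite dimension, if [S] is semisimple and [N] is nilpotent and commutes
    with [S], any operator acting on each eigenspace of [S] by a scalar that
    depends only on the eigenvalue is a polynomial in [S + N].  By incommensurability
    the [X^s]-weight of a monomial tensor determines its [Z_k]-weight, so modulo
    any power of the maximal ideal the Lie derivative along [Z_k] is a polynomial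
    in the one along [X].

    Write [Lambda = Omega / f] and [Y = L_X - g].  The hypothesis says
    [f * Y Omega = X(f) * Omega]; cancelling [f] repeatedly gives
    [f * P(Y) Omega = P(X)(f) * Omega] for every polynomial [P].  If [g = 0], a
    [P] representing [Z_k] yields (i).  For general [g], the function [1] is
    decomposed into generalized eigenvectors of [X - g]; with [P(Y)] the operator
    associated with [Z_k], the Leibniz rule gives
    [P(Y) Omega = L_{Z_k} Omega + P(X - g)(1) * Omega], and [- P(X - g)(1)]
    converges, as the power of the maximal ideal grows, to the function [g_k]
    of (ii). *)

(** * Polynomials in an operator and generalized eigenvectors *)

(** Chinese remaindering: the moduli at distinct nodes are coprime, and the hypothesis on [s] makes
    repeated nodes consistent. *)
Lemma hermite_interp (C : fieldType) (s : seq (C * C)) (M : nat) :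
  {in s &, forall x y, x.1 = y.1 -> x.2 = y.2} ->
  exists p : {poly C}, {in s, forall x, ('X - x.1%:P) ^+ M %| p - x.2%:P}.
Proof.
elim: s => [|[l k] s IHs] inj_s; first by exists 0.
have [x y xs ys|p Pp] := IHs; first by apply: inj_s; rewrite inE ?xs ?ys orbT.
have [/mapP[[l' k'] xs /= ll']|l_s] := boolP (l \in map fst s).
  exists p => x; rewrite inE => /predU1P[->|]; last exact: Pp.
  have -> : k = k' by apply: (inj_s (l, k) (l', k')); rewrite ?inE ?eqxx ?xs ?orbT.
  rewrite /= ll'.
  exact: (Pp (l', k')).
pose chi := \prod_(x <- s) ('X - x.1%:P) ^+ M.
have cop : coprimep chi (('X - l%:P) ^+ M).
  apply/coprimep_expr; rewrite /chi; elim: s l_s {IHs inj_s Pp chi} => [|x s IHs].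
    by rewrite big_nil coprime1p.
  rewrite /= inE negb_or big_cons coprimepMl => /andP[ne ns]; rewrite IHs // andbT.
  apply/coprimep_expl; rewrite coprimep_XsubC root_XsubC; exact: ne.
have /Bezout_eq1_coprimepP[[u v] /= uv] := cop.
(* [u * chi] is 1 modulo the new modulus and 0 modulo the old ones, so the correction affects only
   the new node. *)
exists (p + (k%:P - p) * (u * chi)) => x; rewrite inE => /predU1P[->|xs] /=.
  have -> : p + (k%:P - p) * (u * chi) - k%:P
     = (p - k%:P) * v * ('X - l%:P) ^+ M.
    have -> : u * chi = 1 - v * ('X - l%:P) ^+ M by rewrite -uv addrK.
    ring.
  exact: dvdp_mull.
rewrite addrAC dvdp_add ?Pp // dvdp_mull // dvdp_mull //.
by rewrite /chi (big_rem x xs) /= dvdp_mulr.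
Qed.

Section Operators.
Variables (C : fieldType) (R : comNzRingType) (cst : {rmorphism C -> R}).

Section OneModule.
Variable V : lmodType R.
Implicit Types (u v w : V) (Y : V -> V) (F : V -> Prop) (p q : {poly C}).

(** Derivations are linear over the constants [cst c] only, whereas the subspaces to be divided out
    are modules over [R]. *)
Definition clinear Y :=
  (forall u v, Y (u + v) = Y u + Y v) /\ (forall c v, Y (cst c *: v) = cst c *: Y v).
Definition submod F :=
  [/\ F 0, forall u v, F u -> F v -> F (u + v) & forall a v, F v -> F (a *: v)].
Definition stable F Y := forall v, F v -> F (Y v).

Definition act Y p v := \sum_(i < size p) cst p`_i *: iter i Y v.
Definition shift Y (l : C) v := Y v - cst l *: v.
(** Generalized eigenvectors of the quotient by [F], expressed upstairs so that no quotient module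
    is formed. *)
Definition geig F Y l v := exists M, F (iter M (shift Y l) v).

(* Modulo [F], [w] is the image of [v] under the operator that acts on the
   generalized eigenspace of [Y] for [l] as the scalar [k] with [K l k]. *)
Inductive ss_action F Y (K : C -> C -> Prop) : V -> V -> Prop :=
| SsGeig l k v : K l k -> geig F Y l v -> ss_action F Y K v (cst k *: v)
| SsAdd v w v' w' : ss_action F Y K v w -> ss_action F Y K v' w' ->
    ss_action F Y K (v + v') (w + w')
| SsFlt v w : F v -> F w -> ss_action F Y K v w.

Section Linear.
Variables (Y : V -> V) (linY : clinear Y).

Lemma clin0 : Y 0 = 0.
Proof. by have [_ /(_ 0 0)] := linY; rewrite rmorph0 !scale0r. Qed.
Lemma clinN v : Y (- v) = - Y v.
Proof. by apply/eqP; rewrite -addr_eq0 -(proj1 linY) addNr clin0. Qed.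
Lemma clinB u v : Y (u - v) = Y u - Y v.
Proof. by rewrite (proj1 linY) clinN. Qed.
Lemma clin_sum I (r : seq I) (P : pred I) (E : I -> V) :
  Y (\sum_(i <- r | P i) E i) = \sum_(i <- r | P i) Y (E i).
Proof. exact: (big_morph Y (proj1 linY) clin0). Qed.

Lemma clin_iter m : clinear (iter m Y).
Proof.
by elim: m => [|m [D Z]]; split=> // *; rewrite !iterS ?D ?Z ?(proj1 linY) ?(proj2 linY).
Qed.

Lemma clin_shift l : clinear (shift Y l).
Proof.
split=> [u v|c v]; rewrite /shift.
  by rewrite (proj1 linY) scalerDr opprD addrACA.
by rewrite (proj2 linY) scalerBr !scalerA mulrC.
Qed.

End Linear.

Section PolyAction.
Variables (Y : V -> V) (linY : clinear Y).

Lemma act_widen m p v : (size p <= m)%N ->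
  act Y p v = \sum_(i < m) cst p`_i *: iter i Y v.
Proof.
move=> pm; rewrite /act (big_ord_widen _ (fun i => cst p`_i *: iter i Y v) pm).
rewrite big_mkcond; apply: eq_bigr => i _; case: ltnP => // ip.
by rewrite nth_default // rmorph0 scale0r.
Qed.

Lemma actDp p q v : act Y (p + q) v = act Y p v + act Y q v.
Proof.
pose m := maxn (size p) (size q).
rewrite (@act_widen m (p + q)) ?size_polyD // (@act_widen m p) ?leq_maxl //.
rewrite (@act_widen m q) ?leq_maxr // -big_split /=; apply: eq_bigr => i _.
by rewrite coefD rmorphD scalerDl.
Qed.

Lemma actCp c v : act Y c%:P v = cst c *: v.
Proof. by rewrite (@act_widen 1) ?size_polyC_leq1 // big_ord1 coefC. Qed.

Lemma actXp p v : act Y (p * 'X) v = Y (act Y p v).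
Proof.
have sz : (size (p * 'X)%R <= (size p).+1)%N.
  by rewrite (leq_trans (size_polyMleq _ _)) // size_polyX addn2.
rewrite (@act_widen _ _ v sz).
rewrite big_ord_recl coefMX /= rmorph0 scale0r add0r /act (clin_sum linY).
by apply: eq_bigr => i _; rewrite coefMX /= (proj2 linY).
Qed.

Lemma actNp p v : act Y (- p) v = - act Y p v.
Proof. by apply/eqP; rewrite -addr_eq0 -actDp addNr -polyC0 actCp rmorph0 scale0r. Qed.

Lemma act_clin p : clinear (act Y p).
Proof.
split=> [u v|c v]; rewrite /act.
  by rewrite -big_split; apply: eq_bigr => i _; rewrite (proj1 (clin_iter linY _)) scalerDr.
rewrite scaler_sumr; apply: eq_bigr => i _.
by rewrite (proj2 (clin_iter linY _)) !scalerA mulrC.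
Qed.

Lemma actM p q v : act Y (p * q) v = act Y p (act Y q v).
Proof.
elim/poly_ind: p => [|p c IHp]; first by rewrite mul0r -polyC0 !actCp rmorph0 !scale0r.
rewrite mulrDl mulrAC actDp actXp IHp actDp actXp actCp; congr (_ + _).
elim/poly_ind: q {IHp} => [|q d IHq]; first by rewrite mulr0 -polyC0 !actCp rmorph0 scale0r scaler0.
rewrite mulrDr mulrA -polyCM !actDp !actXp !actCp IHq (proj2 linY) scalerDr.
by rewrite rmorphM scalerA.
Qed.

Lemma act_XsubC l v : act Y ('X - l%:P) v = shift Y l v.
Proof.
by rewrite -[X in X - _]mul1r actDp actNp actCp -polyC1 actXp actCp rmorph1 scale1r.
Qed.

Lemma act_XsubC_exp l M v : act Y (('X - l%:P) ^+ M) v = iter M (shift Y l) v.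
Proof.
elim: M => [|M IH]; first by rewrite expr0 -polyC1 actCp rmorph1 scale1r.
by rewrite exprS actM IH act_XsubC.
Qed.

End PolyAction.

Lemma shift0 Y : shift Y 0 = Y.
Proof. by apply: funext => v; rewrite /shift rmorph0 scale0r subr0. Qed.

(** As [YD] commutes with [YS], its iterates stay in the [l]-eigenspace of [YS], where [Y - l] is
    just [YD]. *)
Lemma shift_eigen (Y YS YD : V -> V) l v :
  (forall v, Y v = YS v + YD v) -> (forall v, YS (YD v) = YD (YS v)) ->
  clinear YD -> YS v = cst l *: v ->
  forall m, iter m (shift Y l) v = iter m YD v.
Proof.
move=> YE comm linD eig m.
have eigm k : YS (iter k YD v) = cst l *: iter k YD v.
  by elim: k => //= k IH; rewrite comm IH (proj2 linD).
by elim: m => //= m ->; rewrite /shift YE eigm addrC addKr.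
Qed.

Section Submodule.
Variables (F : V -> Prop) (subF : submod F).

Lemma subm0 : F 0. Proof. by case: subF. Qed.
Lemma submD u v : F u -> F v -> F (u + v). Proof. by case: subF => _ + _; apply. Qed.
Lemma submZ a v : F v -> F (a *: v). Proof. by case: subF => _ _; apply. Qed.
Lemma submN v : F v -> F (- v). Proof. by rewrite -scaleN1r; apply: submZ. Qed.
Lemma submB u v : F u -> F v -> F (u - v).
Proof. by move=> Fu /submN; apply: submD. Qed.
Lemma subm_sum I (r : seq I) (P : pred I) (E : I -> V) :
  (forall i, P i -> F (E i)) -> F (\sum_(i <- r | P i) E i).
Proof. by move=> FE; elim/big_ind: _ => //; [exact: subm0 | exact: submD]. Qed.

Lemma stable_iter Y m : stable F Y -> stable F (iter m Y).
Proof. by move=> FY; elim: m => // m IH v Fv; apply/FY/IH. Qed.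
Lemma stable_act Y p : stable F Y -> stable F (act Y p).
Proof. by move=> FY v Fv; apply: subm_sum => i _; apply/submZ/stable_iter. Qed.
Lemma stable_shift Y l : stable F Y -> stable F (shift Y l).
Proof. by move=> FY v Fv; apply: submB; [apply: FY|apply: submZ]. Qed.
End Submodule.

Section Semisimple.
Variables (Y : V -> V) (linY : clinear Y) (F : V -> Prop) (subF : submod F).
Hypothesis FY : stable F Y.

Lemma geig_flt l v : F v -> geig F Y l v.
Proof. by exists 0%N. Qed.

Lemma geig_leq l v M M' : (M <= M')%N ->
  F (iter M (shift Y l) v) -> F (iter M' (shift Y l) v).
Proof.
move=> /subnK <-; rewrite iterD => Fv.
exact: (stable_iter _ (stable_shift subF l FY)).
Qed.

Lemma geigD l u v : geig F Y l u -> geig F Y l v -> geig F Y l (u + v).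
Proof.
move=> [M Fu] [M' Fv]; exists (maxn M M').
rewrite (proj1 (clin_iter (clin_shift linY l) _)); apply: (submD subF).
  by apply: geig_leq Fu; rewrite leq_maxl.
by apply: geig_leq Fv; rewrite leq_maxr.
Qed.

Lemma geig_act l p v : geig F Y l v -> geig F Y l (act Y p v).
Proof.
move=> [M Fv]; exists M.
rewrite -(act_XsubC_exp linY) -(actM linY) mulrC (actM linY) (act_XsubC_exp linY).
exact: stable_act.
Qed.

Lemma geig_sum l I (r : seq I) (P : pred I) (E : I -> V) :
  (forall i, P i -> geig F Y l (E i)) -> geig F Y l (\sum_(i <- r | P i) E i).
Proof.
move=> gE; elim/big_ind: _ => //; [exact: geig_flt (subm0 subF) | exact: geigD].
Qed.

Lemma geig_iter l m v : geig F Y l (iter m (shift Y l) v) -> geig F Y l v.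
Proof. by move=> [M]; rewrite -iterD; exists (M + m)%N. Qed.

Lemma ss_mono (K K' : C -> C -> Prop) v w :
  (forall l k, K l k -> K' l k) -> ss_action F Y K v w -> ss_action F Y K' v w.
Proof.
move=> KK; elim=> {v w} [l k v Kl gv|v w v' w' _ IH _ IH'|v w Fv Fw].
- exact: SsGeig (KK _ _ Kl) gv.
- exact: SsAdd.
- exact: SsFlt.
Qed.

Lemma ss_sum K I (r : seq I) (P : pred I) (E E' : I -> V) :
  (forall i, P i -> ss_action F Y K (E i) (E' i)) ->
  ss_action F Y K (\sum_(i <- r | P i) E i) (\sum_(i <- r | P i) E' i).
Proof.
move=> EE'; elim/big_rec2: _ => [|i u v Pi]; last by apply: SsAdd; apply: EE'.
by apply: SsFlt; apply: subm0.
Qed.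

(** A derivation of [ss_action] involves finitely many eigenvalues and nilpotency exponents,
    recorded in [s] and [M0]. Allowing every interpolating [p] lets one polynomial serve several
    derivations at once. *)
Lemma ss_poly K v w : ss_action F Y K v w ->
  exists s : seq (C * C), exists M0, {in s, forall x, K x.1 x.2} /\
  forall M p, (M0 <= M)%N ->
    {in s, forall x, ('X - x.1%:P) ^+ M %| p - x.2%:P} -> F (act Y p v - w).
Proof.
elim=> {v w} [l k v Kl [M0 gv]|v w v' w' _ [s [M [Ks H]]] _ [s' [M' [Ks' H']]]|v w Fv Fw].
- exists [:: (l, k)], M0; split=> [x|M p MM /(_ (l, k))]; first by rewrite inE => /eqP ->.
  rewrite inE eqxx => /(_ isT) /= /dvdpP[q e].
  have -> : act Y p v - cst k *: v = act Y q (iter M (shift Y l) v).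
    rewrite -(act_XsubC_exp linY) -(actM linY) -e actDp actNp.
    by rewrite actCp.
  exact/(stable_act subF)/geig_leq/gv.
- exists (s ++ s'), (maxn M M'); split=> [x|M1 p]; first by rewrite mem_cat => /orP[/Ks|/Ks'].
  rewrite geq_max => /andP[le1 le2] sp; rewrite (proj1 (act_clin linY p)) opprD addrACA.
  apply: (submD subF).
    by apply: H le1 _ => x xs; apply: sp; rewrite mem_cat xs.
  by apply: H' le2 _ => x xs; apply: sp; rewrite mem_cat xs orbT.
- exists [::], 0%N; split=> // M p _ _; apply: (submB subF) => //; exact: stable_act.
Qed.

(** Modulo [F], Bezout makes [Y - l0] invertible on the generalized eigenspaces for [l != l0]; those
    components of [u] have a preimage [u'], and only the [l0] component remains. *)
Lemma ss_split l0 K u w : ss_action F Y K u w ->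
  exists u' w', ss_action F Y K u' w' /\ geig F Y l0 (u - shift Y l0 u').
Proof.
have sh0 : shift Y l0 0 = 0 by apply/clin0/clin_shift.
elim=> {u w} [l k u Kl gu|u w v z _ [u' [w' [J g]]] _ [v' [z' [J' g']]]|u w Fu Fw].
- have [ll|ne] := eqVneq l l0.
    exists 0, 0; rewrite sh0 subr0; split; last by rewrite -ll.
    by apply: SsFlt; apply: subm0.
  have [M gM] := gu.
  have cop : coprimep ('X - l0%:P) (('X - l%:P) ^+ M).
    by apply: coprimep_expr; rewrite coprimep_XsubC root_XsubC.
  have /Bezout_eq1_coprimepP[[a b] /= ab] := cop.
  exists (act Y a u), (cst k *: act Y a u); split; first exact: SsGeig (geig_act _ gu).
  apply: geig_flt.
  have -> : u - shift Y l0 (act Y a u) = act Y b (iter M (shift Y l) u).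
    rewrite -(act_XsubC linY) -(act_XsubC_exp linY) -!(actM linY).
    rewrite -{1}[u]scale1r -(rmorph1 cst) -(actCp Y) polyC1 -ab actDp.
    by rewrite mulrC addrAC subrr add0r.
  exact: stable_act.
- exists (u' + v'), (w' + z'); split; first exact: SsAdd.
  rewrite (proj1 (clin_shift linY l0)) opprD addrACA; exact: geigD.
- exists 0, 0; rewrite sh0 subr0; split; last exact: geig_flt.
  by apply: SsFlt; apply: subm0.
Qed.

(** Subtracting from [v] the [u'] of the splitting leaves a generalized eigenvector for [l0]. *)
Lemma ss_unshift l0 k0 K v w : K l0 k0 -> ss_action F Y K (shift Y l0 v) w ->
  exists z, ss_action F Y K v z.
Proof.
move=> Kl /(ss_split l0)[u' [w' [J [M g]]]].
have gv : geig F Y l0 (v - u').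
  by exists M.+1; rewrite iterSr (clinB (clin_shift linY l0)).
exists (cst k0 *: (v - u') + w'); rewrite -{1}[v](subrK u').
by apply: SsAdd => //; exact: SsGeig Kl gv.
Qed.

Lemma ss_unshift_iter l0 k0 K m v w : K l0 k0 ->
  ss_action F Y K (iter m (shift Y l0) v) w -> exists z, ss_action F Y K v z.
Proof.
move=> Kl; elim: m v w => [|m IH] v w; first by exists w.
by rewrite iterSr => /IH [z]; apply: (ss_unshift Kl).
Qed.

End Semisimple.

(** Both results are computed by one polynomial interpolating the data of the two derivations;
    functionality of [K] makes these data compatible. *)
Lemma ss_uniq (Y : V -> V) (F F' : V -> Prop) K v w w' :
  clinear Y -> (forall l k k', K l k -> K l k' -> k = k') ->
  submod F -> stable F Y ->
  submod F' -> stable F' Y -> (forall v, F' v -> F v) ->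
  ss_action F Y K v w -> ss_action F' Y K v w' -> F (w - w').
Proof.
move=> linY funK sF FY sF' FY' FF /(ss_poly linY sF FY)[s [M [Ks H]]].
move=> /(ss_poly linY sF' FY')[s' [M' [Ks' H']]].
have [|p Pp] := @hermite_interp C (s ++ s') (maxn M M').
  move=> x y xs ys e; apply: (funK x.1); last rewrite e.
    by move: xs; rewrite mem_cat => /orP[/Ks|/Ks'].
  by move: ys; rewrite mem_cat => /orP[/Ks|/Ks'].
have -> : w - w' = (act Y p v - w') - (act Y p v - w) by rewrite opprB [RHS]addrC addrA subrK.
apply: (submB sF).
  apply/FF/(H' _ _ (leq_maxr _ _)) => x xs; apply: Pp; by rewrite mem_cat xs orbT.
apply/(H _ _ (leq_maxl _ _)) => x xs; apply: Pp; by rewrite mem_cat xs.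
Qed.
End OneModule.

(** * Leibniz rules for generalized eigenvectors *)

Section Leibniz.
Variable V : lmodType R.

(** Expanding [E^M (a v)] gives multiples of the terms [A^i a * B^j v] with [i + j = M]; closure of
    [F] under sums absorbs the binomial coefficients. *)
Lemma leibniz_iter (A : R -> R) (B E : V -> V) (F : V -> Prop) M a v :
  (forall u v, E (u + v) = E u + E v) -> 
  (forall a v, E (a *: v) = A a *: v + a *: B v) ->
  (forall u v, F u -> F v -> F (u + v)) ->
  (forall i j, (i + j)%N = M -> F (iter i A a *: iter j B v)) ->
  F (iter M E (a *: v)).
Proof.
move=> ED EZ FD; elim: M a v => [|M IH] a v H; first exact: (H 0%N 0%N).
have iterD u w : iter M E (u + w) = iter M E u + iter M E w.
  by elim: M {IH H} => //= M ->; rewrite ED.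
rewrite iterSr EZ iterD; apply: FD; apply: IH => i j ij.
  by rewrite -iterSr; apply: H; rewrite addSn ij.
by rewrite -(iterSr j); apply: H; rewrite addnS ij.
Qed.

Variables (X : R -> R) (L Y : V -> V) (FR : R -> Prop) (F : V -> Prop).
Hypotheses (linX : @clinear R^o X) (linL : clinear L) (linY : clinear Y).
Hypothesis YZ : forall a v, Y (a *: v) = X a *: v + a *: L v.
Hypotheses (subFR : @submod R^o FR) (subF : submod F).
Hypotheses (FRX : @stable R^o FR X) (FL : stable F L).
Hypothesis FRF : forall a v, FR a -> F (a *: v).

(** On products [Y - (l + m)] obeys the Leibniz rule with [X - l] and [L - m]. After [M + M'] steps
    every term has [i >= M] or [j >= M']. *)
Lemma geigZ l m a v : @geig R^o FR X l a -> geig F L m v -> geig F Y (l + m) (a *: v).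
Proof.
move=> [M ga] [M' gv]; exists (M + M')%N.
apply: (@leibniz_iter (@shift R^o X l) (shift L m)).
- exact: (proj1 (clin_shift linY _)).
- move=> b w; rewrite /shift YZ scalerBl scalerBr rmorphD.
  by rewrite scalerDl opprD addrACA !scalerA [b * _]mulrC.
- exact: submD.
- move=> i j ij; have [Mi|iM] := leqP M i.
    by apply: FRF; apply: (@geig_leq R^o _ _ subFR FRX l _ M).
  by apply: (submZ subF); apply: (geig_leq subF FL (M := M')) => //; lia.
Qed.

(** Weights add under products, so scaling by weight again satisfies a Leibniz rule. Three relations
    occur because the eigenvalues of [X], [L] and [Y] may be offset against one another. *)
Lemma ssZ (K1 K0 K : C -> C -> Prop) a a' v v' :
  (forall l k m h, K1 l k -> K0 m h -> K (l + m) (k + h)) ->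
  @ss_action R^o FR X K1 a a' -> ss_action F L K0 v v' ->
  ss_action F Y K (a *: v) (a' *: v + a *: v').
Proof.
move=> KK Ja Jv; elim: Ja => {a a'} [l k a Kl ga|a a' b b' _ IH _ IH'|a a' Fa Fa'].
- elim: Jv => {v v'} [m h v Km gv|v v' w w' _ IH _ IH'|v v' Fv Fv'].
  + have -> : (cst k *: a : R^o) *: v + a *: (cst h *: v) = cst (k + h) *: (a *: v).
      by rewrite rmorphD scalerDl !scalerA [a * _]mulrC.
    exact: SsGeig (KK _ _ _ _ Kl Km) (geigZ ga gv).
  + by rewrite !scalerDr addrACA; apply: SsAdd.
  + by apply: SsFlt; [|apply: submD => //]; apply: submZ.
- by rewrite !scalerDl addrACA; apply: SsAdd.
- by apply: SsFlt; [|apply: submD => //]; apply: FRF.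
Qed.

End Leibniz.

(** * Cancelling the denominator [f] *)

Section Ratio.
Variables (V : lmodType R) (X : R -> R) (Y : V -> V).
Hypotheses (linX : @clinear R^o X) (linY : clinear Y).
Hypothesis YZ : forall a v, Y (a *: v) = X a *: v + a *: Y v.
Variables (f : R) (om : V).
Hypothesis regf : forall v : V, f *: v = 0 -> v = 0.
Hypothesis fY : f *: Y om = X f *: om.

(* Formally [Y^j om / om = X^j f / f]; the factor [f] is cancelled at each step. *)
Lemma ratio_iter j : f *: iter j Y om = iter j X f *: om.
Proof.
elim: j => // j IH.
have := congr1 Y IH; rewrite !YZ => e.
have {}e : f *: iter j.+1 Y om = iter j.+1 X f *: om + (iter j X f *: Y om - X f *: iter j Y om).
  by rewrite addrA /= -e [RHS]addrC addKr.
apply/eqP; rewrite -subr_eq0; apply/eqP/regf.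
rewrite e addrC addKr scalerBr !scalerA [f * X f]mulrC [f * iter _ _ _]mulrC.
by rewrite -!scalerA IH fY !scalerA mulrC subrr.
Qed.

Lemma ratio_act p : f *: act Y p om = @act R^o X p f *: om.
Proof.
rewrite /act scaler_sumr scaler_suml; apply: eq_bigr => i _.
by rewrite scalerA mulrC -scalerA ratio_iter scalerA.
Qed.

(** A single polynomial represents both actions, and [ratio_act] compares its values on [f] and
    [om]. For it to exist, [K] must be functional on the eigenvalues of [X] and [Y] together. *)
Lemma ss_ratio (FR : R -> Prop) (F : V -> Prop) K f' om' :
  @submod R^o FR -> submod F -> @stable R^o FR X -> stable F Y ->
  (forall a v, FR a -> F (a *: v)) ->
  (forall l k k', K l k -> K l k' -> k = k') ->
  @ss_action R^o FR X K f f' -> ss_action F Y K om om' ->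
  F (f *: om' - f' *: om).
Proof.
move=> sFR sF FRX FY FRF funK.
move=> /(ss_poly linX sFR FRX)[s [M [Ks H]]].
move=> /(ss_poly linY sF FY)[s' [M' [Ks' H']]].
have [|p Pp] := @hermite_interp C (s ++ s') (maxn M M').
  move=> x y xs ys e; apply: (funK x.1); last rewrite e.
    by move: xs; rewrite mem_cat => /orP[/Ks|/Ks'].
  by move: ys; rewrite mem_cat => /orP[/Ks|/Ks'].
have -> : f *: om' - f' *: om =
    (@act R^o X p f - f') *: om - f *: (act Y p om - om').
  by rewrite scalerBl scalerBr ratio_act opprB [RHS]addrC addrA subrK.
apply: (submB sF).
  apply/FRF/(H _ _ (leq_maxl _ _)) => x xs; apply: Pp; by rewrite mem_cat xs.
apply/(submZ sF)/(H' _ _ (leq_maxr _ _)) => x xs; apply: Pp; by rewrite mem_cat xs orbT.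
Qed.

End Ratio.
End Operators.

(** * The ring of formal power series *)

(** The box of exponents in [fps_mul] depends on the coefficient being computed; enlarging it to a
    common size adds no index satisfying [P]. *)
Lemma big_ffun_widen (C : nmodType) (n A B : nat) (P : pred (mindex n))
    (F : mindex n -> C) :
    (A <= B)%N -> (forall b, P b -> forall i, (b i <= A)%N) ->
  \sum_(b : {ffun 'I_n -> 'I_A.+1} | P (fun i => nat_of_ord (b i))) F (fun i => nat_of_ord (b i))
  = \sum_(b : {ffun 'I_n -> 'I_B.+1} | P (fun i => nat_of_ord (b i))) F (fun i => nat_of_ord (b i)).
Proof.
move=> AB PA.
pose h (b : {ffun 'I_n -> 'I_A.+1}) : {ffun 'I_n -> 'I_B.+1} := [ffun i => inord (b i)].
pose h' (b : {ffun 'I_n -> 'I_B.+1}) : {ffun 'I_n -> 'I_A.+1} := [ffun i => inord (b i)].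
have hE b : (fun i => nat_of_ord (h b i)) = (fun i => nat_of_ord (b i)).
  by apply: funext => i; rewrite ffunE inordK // ltnS (leq_trans _ AB) // -ltnS.
rewrite [RHS](reindex_onto h h') /=; last first.
  move=> b Pb; apply/ffunP => i; apply: val_inj; rewrite !ffunE /=.
  have bA : (b i < A.+1)%N by rewrite ltnS (PA _ Pb).
  by rewrite [(inord (b i) : 'I_A.+1) : nat]inordK // inordK.
apply: eq_big => [b|b _]; rewrite hE //.
rewrite [X in _ = _ && X](_ : _ = true) ?andbT //.
apply/eqP/ffunP => i; apply: val_inj; rewrite !ffunE /= inordK ?ltn_ord //.
  by rewrite inordK // ltnS (leq_trans _ AB) // -ltnS.
by rewrite inordK // ltnS (leq_trans _ AB) // -ltnS.
Qed.

HB.instance Definition _ (C : Type) n := gen_eqMixin (fps C n).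
HB.instance Definition _ (C : Type) n := gen_choiceMixin (fps C n).

Section FpsRing.
Variables (C : numClosedFieldType) (n : nat).
Implicit Types (f g h : fps C n) (al : mindex n).

Lemma fpsP f g : (forall al, f al = g al) -> f = g.
Proof. by move=> fg; apply: funext. Qed.

Fact fps_addA : associative (@fps_add C n).
Proof. by move=> f g h; apply: fpsP => al; rewrite /fps_add addrA. Qed.
Fact fps_addC : commutative (@fps_add C n).
Proof. by move=> f g; apply: fpsP => al; rewrite /fps_add addrC. Qed.
Fact fps_add0 : left_id (@fps0 C n) (@fps_add C n).
Proof. by move=> f; apply: fpsP => al; rewrite /fps_add add0r. Qed.
Fact fps_addN : left_inverse (@fps0 C n) (@fps_opp C n) (@fps_add C n).
Proof. by move=> f; apply: fpsP => al; rewrite /fps_add /fps_opp addNr. Qed.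

HB.instance Definition _ := GRing.isZmodule.Build (fps C n)
  fps_addA fps_addC fps_add0 fps_addN.

Definition mi_of B (b : {ffun 'I_n -> 'I_B.+1}) : mindex n := fun i => nat_of_ord (b i).

Lemma mi_ofK B al : (forall i, (al i <= B)%N) ->
  mi_of [ffun i => (inord (al i) : 'I_B.+1)] = al.
Proof. by move=> alB; apply: funext => i; rewrite /mi_of ffunE inordK ?ltnS. Qed.

Lemma mi_of_inj B : injective (@mi_of B).
Proof.
by move=> b c bc; apply/ffunP => i; apply: val_inj; rewrite /= -!/(mi_of _ i) bc.
Qed.

Definition mi_add al be : mindex n := fun i => (al i + be i)%N.
Definition mi_eq al be := [forall i, al i == be i].

Lemma mi_eqP al be : reflect (al = be) (mi_eq al be).
Proof.
apply: (iffP forallP) => [e|-> //]; by apply: funext => i; apply/eqP.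
Qed.

(** A form of the product symmetric in the two factors, over any large enough box: the algebra laws
    become exchanges of sums. *)
Lemma fps_mulE B f g al : (forall i, (al i <= B)%N) ->
  fps_mul f g al = \sum_(b : {ffun 'I_n -> 'I_B.+1}) \sum_(c : {ffun 'I_n -> 'I_B.+1})
    f (mi_of b) * g (mi_of c) *+ mi_eq (mi_add (mi_of b) (mi_of c)) al.
Proof.
move=> alB; rewrite /fps_mul.
set A := \max_(i < n) al i.
have AB : (A <= B)%N by apply/bigmax_leqP.
have alA i : (al i <= A)%N by apply: leq_bigmax.
pose P (b : mindex n) := [forall i, (b i <= al i)%N].
have PA b : P b -> forall i, (b i <= A)%N.
  by move=> /forallP Pb i; apply: leq_trans (Pb i) (alA i).
have := @big_ffun_widen C n A B P (fun b => f b * g (fun i => (al i - b i)%N)) AB PA.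
rewrite /P => ->.
rewrite big_mkcond /=; apply: eq_bigr => b _.
case: ifPn => [/forallP le_b|nle_b].
  pose c0 : {ffun 'I_n -> 'I_B.+1} := [ffun i => inord (al i - b i)].
  have c0E : mi_of c0 = fun i => (al i - b i)%N.
    by apply: (@mi_ofK B (fun i => (al i - b i)%N)) => i; rewrite (leq_trans (leq_subr _ _)) ?alB.
  rewrite (bigD1 c0) //= big1 ?addr0 => [|c ne_c].
    rewrite c0E; have -> : mi_eq (mi_add (mi_of b) (fun i => (al i - b i)%N)) al.
      by apply/forallP => i; rewrite /mi_add /mi_of subnKC ?le_b.
    by rewrite mulr1n.
  case: mi_eqP => // e; case/eqP: ne_c; apply: mi_of_inj; rewrite c0E -e.
  by apply: funext => i; rewrite /mi_add /mi_of addKn.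
rewrite big1 // => c _; case: mi_eqP => // e; case/negP: nle_b; apply/forallP => i.
by rewrite -e /mi_add leq_addr.
Qed.

Definition mi_bd al := \max_(i < n) al i.
Lemma mi_bdP al i : (al i <= mi_bd al)%N.
Proof. exact: leq_bigmax. Qed.

Fact fps_mulC : commutative (@fps_mul C n).
Proof.
move=> f g; apply: fpsP => al; rewrite !(fps_mulE _ _ (mi_bdP al)).
rewrite exchange_big /=; apply: eq_bigr => b _; apply: eq_bigr => c _.
rewrite mulrC; congr (_ *+ nat_of_bool (mi_eq _ _)).
by apply: funext => i; rewrite /mi_add addnC.
Qed.

Fact fps_mulA : associative (@fps_mul C n).
Proof.
(* The triple product becomes a sum over triples of exponents, visibly symmetric; with commutativity
   this gives associativity. *)
have key f g h al : fps_mul (fps_mul f g) h al =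
   \sum_(b : {ffun 'I_n -> 'I_(mi_bd al).+1}) \sum_(c : {ffun 'I_n -> 'I_(mi_bd al).+1})
   \sum_(d : {ffun 'I_n -> 'I_(mi_bd al).+1})
    f (mi_of b) * g (mi_of c) * h (mi_of d)
      *+ mi_eq (mi_add (mi_add (mi_of b) (mi_of c)) (mi_of d)) al.
  set B := mi_bd al.
  rewrite (fps_mulE _ _ (mi_bdP al)) -/B.
  under eq_bigr => x _.
    under eq_bigr => d _.
      rewrite (@fps_mulE B); last by move=> i; rewrite -ltnS ltn_ord.
      rewrite mulr_suml -sumrMnl.
      under eq_bigr => b _ do rewrite mulr_suml -sumrMnl.
      over.
    rewrite exchange_big /=.
    under eq_bigr => b _ do rewrite exchange_big /=.
    over.
  rewrite exchange_big /=; apply: eq_bigr => b _.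
  rewrite exchange_big /=; apply: eq_bigr => c _.
  rewrite exchange_big /=; apply: eq_bigr => d _.
  case: mi_eqP => [e|ne].
    have bcB i : (mi_add (mi_of b) (mi_of c) i <= B)%N.
      by rewrite (leq_trans _ (mi_bdP al i)) // -e leq_addr.
    rewrite (bigD1 [ffun i => inord (mi_add (mi_of b) (mi_of c) i)]) //= big1 ?addr0.
      rewrite mi_ofK // e.
      have -> : mi_eq al al by apply/mi_eqP.
      by have -> : mi_eq (mi_add (mi_of b) (mi_of c)) (mi_add (mi_of b) (mi_of c)) by apply/mi_eqP.
    move=> x ne_x; case: (mi_eqP (mi_add (mi_of b) _)) => [e'|_]; last by rewrite mulr0n mul0r mul0rn.
    by case/eqP: ne_x; apply: mi_of_inj; rewrite mi_ofK // e'.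
  rewrite big1 // => x _; case: (mi_eqP _ al) => // e.
  case: mi_eqP => [e'|_]; last by rewrite mulr0n mul0r mul0rn.
  by case: ne; rewrite e' e.

move=> f g h; apply: fpsP => al; rewrite fps_mulC !key.
under eq_bigr => b _ do rewrite exchange_big /=.
rewrite exchange_big /=.
apply: eq_bigr => b _; apply: eq_bigr => c _; apply: eq_bigr => d _.
rewrite mulrC mulrA; congr (_ *+ nat_of_bool (mi_eq _ _)).
by apply: funext => i; rewrite /mi_add addnC addnA.
Qed.

Definition fps_cst (c : C) : fps C n :=
  fun al => if [forall j, al j == 0%N] then c else 0.

Lemma mi_add0 be : mi_add (fun _ => 0%N) be = be.
Proof. by apply: funext. Qed.

Lemma fps_cstM c f al : fps_mul (fps_cst c) f al = c * f al.
Proof.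
rewrite (fps_mulE _ _ (mi_bdP al)).
pose z : {ffun 'I_n -> 'I_(mi_bd al).+1} := [ffun i => inord 0].
have zE : mi_of z = fun _ => 0%N by apply: mi_ofK.
pose a : {ffun 'I_n -> 'I_(mi_bd al).+1} := [ffun i => inord (al i)].
have aE : mi_of a = al by apply: mi_ofK => i; apply: mi_bdP.
rewrite (bigD1 z) //= [X in _ + X]big1 ?addr0 => [|b ne_b]; last first.
  rewrite big1 // => d _; rewrite /fps_cst; case: ifP => [/forallP b0|]; last by rewrite mul0r mul0rn.
  case/eqP: ne_b; apply: mi_of_inj; rewrite zE; apply: funext => i.
  by apply/eqP; apply: b0.
rewrite (bigD1 a) //= [X in _ + X]big1 ?addr0 => [|b ne_b]; last first.
  rewrite zE mi_add0; case: mi_eqP => // e; case/eqP: ne_b; apply: mi_of_inj.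
  by rewrite aE.
rewrite zE mi_add0 aE; have -> : mi_eq al al by apply/mi_eqP.
rewrite mulr1n /fps_cst; case: ifP => // /negP; case; exact/forallP.
Qed.

Fact fps_mul1 : left_id (@fps1 C n) (@fps_mul C n).
Proof. by move=> f; apply: fpsP => al; rewrite -[@fps1 C n]/(fps_cst 1) fps_cstM mul1r. Qed.

Fact fps_mulDl : left_distributive (@fps_mul C n) +%R.
Proof.
move=> f g h; apply: fpsP => al; rewrite -[RHS]/(fps_mul f h al + fps_mul g h al) /fps_mul.
rewrite -big_split /=; by apply: eq_bigr => b _; rewrite mulrDl.
Qed.

Fact fps_1neq0 : @fps1 C n != 0.
Proof.
apply/eqP => /(congr1 (fun f : fps C n => f (fun _ => 0%N))).
rewrite /fps1; case: ifP => [_ /eqP|/negP]; first by rewrite oner_eq0.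
by case; apply/forallP.
Qed.

HB.instance Definition _ := GRing.Zmodule_isComNzRing.Build (fps C n)
  fps_mulA fps_mulC fps_mul1 fps_mulDl fps_1neq0.

Lemma fpsD f g al : (f + g) al = f al + g al. Proof. by []. Qed.
Lemma fpsB f g al : (f - g) al = f al - g al. Proof. by []. Qed.
Lemma fps0E al : (0 : fps C n) al = 0. Proof. by []. Qed.
Lemma fps_mulrE f g : fps_mul f g = f * g. Proof. by []. Qed.
Lemma fps_sum I (r : seq I) (P : pred I) (F : I -> fps C n) al :
  (\sum_(i <- r | P i) F i) al = \sum_(i <- r | P i) F i al.
Proof. by elim/big_rec2: _ => // i y1 y2 _ <-. Qed.

Fact fps_cst_zmod : zmod_morphism fps_cst.
Proof.
by move=> c d; apply: fpsP => al; rewrite fpsB /fps_cst; case: ifP; rewrite ?subr0.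
Qed.
Fact fps_cst_monoid : monoid_morphism fps_cst.
Proof.
split=> // c d; apply: fpsP => al; rewrite -fps_mulrE fps_cstM /fps_cst.
by case: ifP; rewrite ?mulr0.
Qed.
HB.instance Definition _ := GRing.isZmodMorphism.Build C (fps C n) fps_cst fps_cst_zmod.
HB.instance Definition _ := GRing.isMonoidMorphism.Build C (fps C n) fps_cst fps_cst_monoid.

Lemma cstME c f al : (fps_cst c * f) al = c * f al.
Proof. exact: fps_cstM. Qed.

End FpsRing.

(** * Derivatives, the filtration by order, and vector fields acting on functions *)

Section FpsCalculus.
Variables (C : numClosedFieldType) (n : nat).
Notation R := (fps C n).
Implicit Types (f g h : R) (al be b c : mindex n) (k : 'I_n).

Definition mdeg al := (\sum_i al i)%N.
Definition mi_unit k : mindex n := fun j => nat_of_bool (j == k).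
Definition mi0 : mindex n := fun _ => 0%N.

Lemma mdegD al be : mdeg (mi_add al be) = (mdeg al + mdeg be)%N.
Proof. by rewrite /mdeg big_split. Qed.

Lemma mdeg_unit k : mdeg (mi_unit k) = 1%N.
Proof. by rewrite /mdeg (bigD1 k) //= /mi_unit eqxx big1 // => i /negPf ->. Qed.

Lemma mdeg_eq0 al : mdeg al = 0%N -> al = mi0.
Proof.
move=> /eqP; rewrite sum_nat_eq0 => /forallP al0; apply: funext => i.
by apply/eqP; apply: (implyP (al0 i)).
Qed.

Lemma mi_incE al k : mi_inc al k = mi_add (mi_unit k) al.
Proof. by apply: funext => i; rewrite /mi_inc /mi_add /mi_unit; case: eqP. Qed.

Lemma mi_pos al k : al k != 0%N -> exists be, al = mi_inc be k.
Proof.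
move=> alk; exists (fun i => (al i - (i == k))%N); apply: funext => i.
by rewrite mi_incE /mi_add /mi_unit subnKC //; case: eqP => // ->; rewrite lt0n.
Qed.

Lemma mdeg_eq1 al : mdeg al = 1%N -> exists k, al = mi_unit k.
Proof.
move=> al1; have [k alk|al0] := pickP (fun k => al k != 0%N); last first.
  suff : mdeg al = 0%N by rewrite al1.
  by rewrite /mdeg big1 // => i _; apply/eqP; move/negbT: (al0 i); rewrite negbK.
have [be e] := mi_pos alk; exists k; move: al1.
rewrite e mi_incE mdegD mdeg_unit => -[/mdeg_eq0 ->].
by apply: funext => i; rewrite /mi_add addn0.
Qed.

Lemma fpsME B f g al : (forall i, (al i <= B)%N) ->
  (f * g) al = \sum_(b : {ffun 'I_n -> 'I_B.+1}) \sum_(c : {ffun 'I_n -> 'I_B.+1})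
    f (mi_of b) * g (mi_of c) *+ mi_eq (mi_add (mi_of b) (mi_of c)) al.
Proof. exact: fps_mulE. Qed.

Lemma fpsM_eq0 f g al :
  (forall b c, mi_add b c = al -> f b * g c = 0) -> (f * g) al = 0.
Proof.
move=> fg0; rewrite (fpsME _ _ (mi_bdP al)) big1 // => b _.
by rewrite big1 // => c _; case: mi_eqP => // /fg0 ->.
Qed.

Lemma mi_addI b : injective (mi_add b).
Proof.
move=> al be e; apply: funext => i; have := congr1 (@^~ i) e.
by rewrite /mi_add => /addnI.
Qed.

Lemma fpsM_single f g b al : (forall b' c, mi_add b' c = mi_add b al -> f b' * g c != 0 -> b' = b) ->
  (f * g) (mi_add b al) = f b * g al.
Proof.
move=> fb; set be := mi_add b al.
rewrite (fpsME _ _ (mi_bdP be)).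
have bB i : (b i <= mi_bd be)%N by rewrite (leq_trans _ (mi_bdP be i)) // leq_addr.
have aB i : (al i <= mi_bd be)%N by rewrite (leq_trans _ (mi_bdP be i)) // leq_addl.
rewrite (bigD1 [ffun i => inord (b i)]) //= [X in _ + X]big1 ?addr0 => [|x ne_x].
  rewrite (bigD1 [ffun i => inord (al i)]) //= [X in _ + X]big1 ?addr0 => [|x ne_x].
    by rewrite !mi_ofK //; case: mi_eqP => // /(_ (erefl _)).
  rewrite mi_ofK //; case: mi_eqP => // /mi_addI e; case/eqP: ne_x.
  by apply: mi_of_inj; rewrite mi_ofK.
apply: big1 => c _; case: mi_eqP => // e; have [->//|ne0] := eqVneq (f (mi_of x) * g (mi_of c)) 0.
by case/eqP: ne_x; apply: mi_of_inj; rewrite mi_ofK //; apply: fb ne0.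
Qed.

(** The coordinates are minimized one after the other, each among the exponents that agree with the
    earlier choices; the result is the lexicographic minimum of the support. *)
Lemma lex_min f : f != 0 -> exists2 b, f b != 0 &
  forall b', f b' != 0 -> forall i : 'I_n, (forall j : 'I_n, (j < i)%N -> b' j = b j) -> (b i <= b' i)%N.
Proof.
move=> f0; have [b0 fb0] : exists b, f b != 0.
  apply: contrapT => nf; case/eqP: f0; apply: fpsP => al.
  by apply/eqP; apply: contrapT => fal; apply: nf; exists al; apply/negP.
suff H (k : nat) : exists2 b, f b != 0 & forall b', f b' != 0 -> forall i : 'I_n, (i < k)%N ->
    (forall j : 'I_n, (j < i)%N -> b' j = b j) -> (b i <= b' i)%N.
  have [b fb Hb] := H n; exists b => // b' fb' i; exact: Hb.
elim: k => [|k [b fb Hb]]; first by exists b0.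
have [kn|nk] := ltnP k n; last first.
  exists b => // b' fb' i _; apply: Hb => //; exact: leq_trans (ltn_ord i) nk.
pose P m := `[< exists2 b', f b' != 0 &
   (forall j : 'I_n, (j < k)%N -> b' j = b j) /\ b' (Ordinal kn) = m >].
have exP : exists m, P m by exists (b (Ordinal kn)); apply/asboolP; exists b.
case: (ex_minnP exP) => m /asboolP[b1 fb1 [b1b b1m]] minm.
exists b1 => // b' fb' i; rewrite ltnS leq_eqVlt => /predU1P[ik|ik] Hj.
  have -> : i = Ordinal kn by apply: val_inj.
  rewrite b1m; apply: minm; apply/asboolP; exists b' => //; split=> // j jk.
  by rewrite Hj ?ik // b1b.
rewrite b1b //; apply: Hb => // j ji; rewrite Hj // b1b //; exact: ltn_trans ji ik.
Qed.

(* The sum of the lexicographically least exponents of [f] and [g] arises from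
   no other pair of exponents. *)
Lemma fpsM_neq0 f g : f != 0 -> g != 0 -> f * g != 0.
Proof.
move=> /lex_min[b fb minb] /lex_min[c gc minc].
apply/eqP => /(congr1 (fun h : R => h (mi_add b c))); rewrite fpsM_single.
  by move/eqP; rewrite mulf_eq0 (negPf fb) (negPf gc).
move=> b' c' e; rewrite mulf_eq0 negb_or => /andP[fb' gc'].
have {}e i : (b' i + c' i = b i + c i)%N by have := congr1 (@^~ i) e.
suff H (k : nat) : forall i : 'I_n, (i < k)%N -> b' i = b i /\ c' i = c i.
  by apply: funext => i; have [] := H n i (ltn_ord i).
elim: k => [//|k IH] i; rewrite ltnS leq_eqVlt => /predU1P[ik|]; last exact: IH.
have le1 : (b i <= b' i)%N by apply: minb => // j ji; have [] := IH j; rewrite -?ik.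
have le2 : (c i <= c' i)%N by apply: minc => // j ji; have [] := IH j; rewrite -?ik.
by have := e i; lia.
Qed.

(** Membership in the [N]-th power of the maximal ideal. *)
Definition flt N f := forall al, (mdeg al < N)%N -> f al = 0.

Lemma flt_leq N M f : (N <= M)%N -> flt M f -> flt N f.
Proof. by move=> NM fM al alN; apply/fM/leq_trans/NM. Qed.
Lemma flt_all f : (forall N, flt N f) -> f = 0.
Proof. by move=> f0; apply: fpsP => al; apply: (f0 (mdeg al).+1). Qed.

Lemma fltM N M f g : flt N f -> flt M g -> flt (N + M) (f * g).
Proof.
move=> fN gM al alNM; apply: fpsM_eq0 => b c e.
have [bN|Nb] := ltnP (mdeg b) N; first by rewrite fN // mul0r.
by rewrite gM ?mulr0 //; move: alNM; rewrite -e mdegD; lia.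
Qed.

Lemma flt_submod N : @submod R R^o (flt N).
Proof.
split=> // [f g fN gN al alN|a f fN].
  by rewrite fpsD fN // gN // addr0.
exact: (@fltM 0).
Qed.

Lemma flt1P f : flt 1 f <-> f mi0 = 0.
Proof.
split=> [f1|f0 al]; first by apply: f1; rewrite /mdeg big1.
by rewrite ltnS leqn0 => /eqP/mdeg_eq0 ->.
Qed.

Lemma cst0E (c : C) : @fps_cst C n c mi0 = c.
Proof. by rewrite /fps_cst; case: ifP => // /negP; case; apply/forallP. Qed.

Lemma flt1_cst f : flt 1 (f - fps_cst (f mi0)).
Proof. by apply/flt1P; rewrite fpsB cst0E subrr. Qed.

Definition fvar k : R := fps_lin 1 k.

Lemma fps_linE (c : C) k al : fps_lin c k al = c *+ mi_eq al (mi_unit k) :> C.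
Proof. by rewrite /fps_lin /mi_eq /mi_unit; case: ifP. Qed.

Lemma fps_lin_var (c : C) k : fps_lin c k = fps_cst c * fvar k.
Proof. by apply: fpsP => al; rewrite cstME /fvar !fps_linE; case: mi_eqP; rewrite ?mulr1 ?mulr0. Qed.

Lemma fvarE k al : fvar k al = (mi_eq al (mi_unit k))%:R.
Proof. exact: fps_linE. Qed.

Lemma fvar_flt k : flt 1 (fvar k).
Proof.
by apply/flt1P; rewrite fvarE; case: mi_eqP => // /(congr1 (@^~ k)); rewrite /mi_unit eqxx.
Qed.

Lemma fvarM_inc k f al : (fvar k * f) (mi_inc al k) = f al.
Proof.
rewrite mi_incE fpsM_single; first by rewrite fvarE; case: mi_eqP => //; rewrite mul1r.
by move=> b c _; rewrite fvarE; case: mi_eqP => // _; rewrite mulr0n mul0r eqxx.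
Qed.

Lemma fvarM_eq0 k f al : al k = 0%N -> (fvar k * f) al = 0.
Proof.
move=> alk; apply: fpsM_eq0 => b c e; rewrite fvarE; case: mi_eqP => [eb|]; last first.
  by rewrite mulr0n mul0r.
by move: alk; rewrite -e eb /mi_add /mi_unit eqxx.
Qed.

Lemma fvarI k : injective (fun f => fvar k * f).
Proof.
by move=> f g e; apply: fpsP => al; rewrite -(fvarM_inc k f) -(fvarM_inc k g) e.
Qed.

Lemma euler k f al : (fvar k * fps_deriv k f) al = (al k)%:R * f al.
Proof.
have [alk|/mi_pos[be ->]] := eqVneq (al k) 0%N; first by rewrite fvarM_eq0 // alk mul0r.
by rewrite fvarM_inc /fps_deriv /mi_inc eqxx.
Qed.

Lemma fps_derivD k f g : fps_deriv k (f + g) = fps_deriv k f + fps_deriv k g.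
Proof. by apply: fpsP => al; rewrite fpsD /fps_deriv fpsD mulrDr. Qed.

(** After multiplication by [x_k], which is injective, the derivative becomes the Euler operator;
    this scales a coefficient by its [k]-th exponent, and exponents add in a product. *)
Lemma fps_derivM k f g : fps_deriv k (f * g) = fps_deriv k f * g + f * fps_deriv k g.
Proof.
apply: (@fvarI k); rewrite mulrDr mulrA mulrCA; apply: fpsP => al.
rewrite euler fpsD !(fpsME _ _ (mi_bdP al)) mulr_sumr -big_split /=.
apply: eq_bigr => b _; rewrite mulr_sumr -big_split /=; apply: eq_bigr => c _.
case: mi_eqP => [e|]; last by rewrite !mulr0n mulr0 addr0.
have -> : al k = (mi_of b k + mi_of c k)%N by rewrite -[LHS](congr1 (@^~ k) e).
by rewrite !mulr1n !euler natrD; ring.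
Qed.

Lemma fps_deriv_cst k (c : C) : fps_deriv k (fps_cst c) = 0.
Proof.
apply: fpsP => al; rewrite /fps_deriv /fps_cst; case: ifP; last by rewrite mulr0.
by move/forallP/(_ k); rewrite /mi_inc eqxx.
Qed.

Lemma fps_derivZ k (c : C) f : fps_deriv k (fps_cst c * f) = fps_cst c * fps_deriv k f.
Proof. by rewrite fps_derivM fps_deriv_cst mul0r add0r. Qed.

Lemma fps_deriv_var k i : fps_deriv k (fvar i) = (k == i)%:R.
Proof.
apply: (@fvarI k); apply: fpsP => al; rewrite euler fvarE.
have [->|ne] := eqVneq k i.
  rewrite mulr1 fvarE; case: mi_eqP => [->|_]; last by rewrite mulr0.
  by rewrite /mi_unit eqxx mulr1.
rewrite mulr0 fps0E; case: mi_eqP => [->|_]; last by rewrite mulr0.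
by rewrite /mi_unit (negPf ne) mul0r.
Qed.

Lemma flt_deriv N k f : flt N.+1 f -> flt N (fps_deriv k f).
Proof.
move=> fN al alN; rewrite /fps_deriv fN ?mulr0 // mi_incE mdegD mdeg_unit; lia.
Qed.

(** Coefficients of the integral over [t] in [[0, 1]] of [(d_k f)(t x)]; the integration gives the
    factor [1 / (|al| + 1)]. *)
Definition hadamard k f : R := fun al => ((mdeg al).+1%:R)^-1 * fps_deriv k f al.

Lemma flt_hadamard N k f : flt N.+1 f -> flt N (hadamard k f).
Proof. by move=> /(flt_deriv k) fN al /fN; rewrite /hadamard => ->; rewrite mulr0. Qed.

(* Euler: [|al| f_al] is the sum of the coefficients of the [x_k d_k f]. *)
Lemma hadamardE f : flt 1 f -> f = \sum_k fvar k * hadamard k f.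
Proof.
move=> f1; apply: fpsP => al; rewrite fps_sum.
have coefE k : (fvar k * hadamard k f) al = (mdeg al)%:R^-1 * ((al k)%:R * f al).
  have [alk|/mi_pos[be ->]] := eqVneq (al k) 0%N.
    by rewrite fvarM_eq0 // alk mul0r mulr0.
  rewrite fvarM_inc /hadamard /fps_deriv mi_incE mdegD mdeg_unit.
  by rewrite /mi_add /mi_unit eqxx.
rewrite (eq_bigr _ (fun k _ => coefE k)) -mulr_sumr -mulr_suml -natr_sum.
have [al0|al0] := eqVneq (mdeg al) 0%N; first by rewrite (mdeg_eq0 al0) (iffLR (flt1P _) f1) !mulr0.
by rewrite mulrA mulVf ?mul1r // pnatr_eq0.
Qed.

Definition mono (b : mindex n) : R := fun al => (mi_eq al b)%:R.

Definition trunc_sum N f : R := \sum_(b : {ffun 'I_n -> 'I_N.+1}) fps_cst (f (mi_of b)) * mono (mi_of b).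

Lemma flt_trunc N f : flt N (f - trunc_sum N f).
Proof.
move=> al alN; rewrite fpsB /trunc_sum fps_sum.
have alB i : (al i <= N)%N.
  by apply: leq_trans (ltnW alN); rewrite /mdeg (bigD1 i) //= leq_addr.
rewrite (bigD1 [ffun i => inord (al i)]) //= [X in _ - (_ + X)]big1 ?addr0 => [|b ne_b].
  by rewrite cstME mi_ofK // /mono; case: mi_eqP => // _; rewrite mulr1 subrr.
rewrite cstME /mono; case: mi_eqP => [e|]; last by rewrite mulr0.
by case/eqP: ne_b; apply: mi_of_inj; rewrite mi_ofK.
Qed.

Section VectorFields.
Implicit Types (X Y : vfield C n).

Lemma vf_applyE X f : vf_apply X f = \sum_k X k * fps_deriv k f.
Proof. by apply: fpsP => al; rewrite fps_sum. Qed.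

Lemma vfD X f g : vf_apply X (f + g) = vf_apply X f + vf_apply X g.
Proof. by rewrite !vf_applyE -big_split; apply: eq_bigr => k _; rewrite fps_derivD mulrDr. Qed.

Lemma vfM X f g : vf_apply X (f * g) = vf_apply X f * g + f * vf_apply X g.
Proof.
rewrite !vf_applyE mulr_suml mulr_sumr -big_split /=; apply: eq_bigr => k _.
by rewrite fps_derivM; ring.
Qed.

Lemma vf_cst X (c : C) : vf_apply X (fps_cst c) = 0.
Proof. by rewrite vf_applyE big1 // => k _; rewrite fps_deriv_cst mulr0. Qed.

Lemma vf_clinear X : @clinear C R (@fps_cst C n) R^o (vf_apply X).
Proof. by split=> [|c f]; [exact: vfD | rewrite [LHS]vfM vf_cst mul0r add0r]. Qed.

(** A derivative lowers the order by at most one, and the coefficient [X k], vanishing at the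
    origin, restores it. *)
Lemma flt_vf X N : (forall k, flt 1 (X k)) -> @stable R R^o (flt N) (vf_apply X).
Proof.
move=> X1; case: N => [//|N] f fN; rewrite vf_applyE.
by apply: (subm_sum (flt_submod N.+1)) => k _; apply: (@fltM 1) (flt_deriv _ fN).
Qed.

Lemma vf_diag gamma f al :
  vf_apply (diag_vf gamma) f al = (\sum_j gamma j * (al j)%:R) * f al.
Proof.
rewrite vf_applyE fps_sum mulr_suml; apply: eq_bigr => k _.
by rewrite /diag_vf fps_lin_var -mulrA cstME euler mulrA.
Qed.

Lemma vf_diag_mono gamma b :
  vf_apply (diag_vf gamma) (mono b) = fps_cst (\sum_j gamma j * (b j)%:R) * mono b.
Proof.
apply: fpsP => al; rewrite vf_diag cstME /mono; case: mi_eqP => [->//|].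
by rewrite !mulr0.
Qed.

End VectorFields.
End FpsCalculus.

(** * Tensor fields *)

HB.instance Definition _ (C : numClosedFieldType) n p q := gen_eqMixin (tensor C n p q).
HB.instance Definition _ (C : numClosedFieldType) n p q := gen_choiceMixin (tensor C n p q).

Section TensorModule.
Variables (C : numClosedFieldType) (n p q : nat).
Notation R := (fps C n).
Notation V := (tensor C n p q).
Implicit Types (S T U : V).

Lemma tensorP S T : (forall I J, S I J = T I J) -> S = T.
Proof. by move=> ST; apply: funext => I; apply: funext => J. Qed.

Definition ten_add S T : V := fun I J => S I J + T I J.
Definition ten_opp S : V := fun I J => - S I J.
Definition ten_zero : V := fun I J => 0.
Definition ten_scale (a : R) S : V := fun I J => a * S I J.

Fact ten_addA : associative ten_add.
Proof. by move=> S T U; apply: tensorP => I J; apply: addrA. Qed.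
Fact ten_addC : commutative ten_add.
Proof. by move=> S T; apply: tensorP => I J; apply: addrC. Qed.
Fact ten_add0 : left_id ten_zero ten_add.
Proof. by move=> S; apply: tensorP => I J; apply: add0r. Qed.
Fact ten_addN : left_inverse ten_zero ten_opp ten_add.
Proof. by move=> S; apply: tensorP => I J; apply: addNr. Qed.
HB.instance Definition _ := GRing.isZmodule.Build V ten_addA ten_addC ten_add0 ten_addN.

Fact ten_scaleA a b S : ten_scale a (ten_scale b S) = ten_scale (a * b) S.
Proof. by apply: tensorP => I J; apply: mulrA. Qed.
Fact ten_scale1 : left_id 1 ten_scale.
Proof. by move=> S; apply: tensorP => I J; apply: mul1r. Qed.
Fact ten_scaleDr : right_distributive ten_scale +%R.
Proof. by move=> a S T; apply: tensorP => I J; apply: mulrDr. Qed.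
Fact ten_scaleDl S : {morph ten_scale^~ S : a b / a + b}.
Proof. by move=> a b; apply: tensorP => I J; apply: mulrDl. Qed.
HB.instance Definition _ := GRing.Zmodule_isLmodule.Build R V
  ten_scaleA ten_scale1 ten_scaleDr ten_scaleDl.

Lemma tenD S T I J : (S + T) I J = S I J + T I J. Proof. by []. Qed.
Lemma tenN S I J : (- S) I J = - S I J. Proof. by []. Qed.
Lemma tenZ a S I J : (a *: S) I J = a * S I J. Proof. by []. Qed.
Lemma ten_sum A (r : seq A) (P : pred A) (F : A -> V) I J :
  (\sum_(i <- r | P i) F i) I J = \sum_(i <- r | P i) F i I J.
Proof. by elim/big_rec2: _ => // i y1 y2 _ <-. Qed.

Definition fltT N T := forall I J, flt N (T I J).

Lemma fltT_submod N : @submod R V (fltT N).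
Proof.
split=> [I J al _ //|S T SN TN I J|a T TN I J].
  exact: (submD (flt_submod C n N)).
exact: (submZ (flt_submod C n N) a).
Qed.

Lemma fltTZ N M a T : flt N a -> fltT M T -> fltT (N + M) (a *: T).
Proof. by move=> aN TM I J; apply: fltM. Qed.

Section Lie.
Implicit Types (X : vfield C n).

Lemma lieE X T I J : lie X T I J = vf_apply X (T I J)
  - \sum_(r < p) \sum_(k < n) T (upd I r k) J * fps_deriv k (X (I r))
  + \sum_(s < q) \sum_(k < n) T I (upd J s k) * fps_deriv (J s) (X k).
Proof.
apply: fpsP => al; rewrite /lie fpsD fpsB !fps_sum.
by congr (_ - _ + _); apply: eq_bigr => r _; rewrite fps_sum.
Qed.

Lemma lieZ X a T : lie X (a *: T) = vf_apply X a *: T + a *: lie X T.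
Proof.
apply: tensorP => I J; rewrite tenD !tenZ !lieE tenZ vfM mulrDr mulrBr -!addrA.
congr (_ + (_ + _)); rewrite !mulr_sumr; congr (- _ + _); apply: eq_bigr => r _;
  by rewrite mulr_sumr; apply: eq_bigr => k _; rewrite tenZ mulrA.
Qed.

Lemma lieD X S T : lie X (S + T) = lie X S + lie X T.
Proof.
apply: tensorP => I J; rewrite !(lieE, tenD) vfD.
under eq_bigr => r _ do under eq_bigr => k _ do rewrite tenD mulrDl.
under eq_bigr => r _ do rewrite big_split.
under [X in _ + X = _]eq_bigr => r _ do under eq_bigr => k _ do rewrite tenD mulrDl.
under [X in _ + X = _]eq_bigr => r _ do rewrite big_split.
rewrite !big_split /=; ring.
Qed.

Lemma lie_clinear X : @clinear C R (@fps_cst C n) V (lie X).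
Proof. by split=> [|c T]; [exact: lieD | rewrite lieZ vf_cst scale0r add0r]. Qed.

Lemma flt_lie X N : (forall k, flt 1 (X k)) -> @stable R V (fltT N) (lie X).
Proof.
move=> X1 T TN I J; rewrite lieE.
apply: (submD (flt_submod C n N)); first apply: (submB (flt_submod C n N)).
- exact: (flt_vf X1).
- by do 2![apply: (subm_sum (flt_submod C n N)) => ? _]; rewrite mulrC; apply: (submZ (flt_submod C n N)).
- by do 2![apply: (subm_sum (flt_submod C n N)) => ? _]; rewrite mulrC; apply: (submZ (flt_submod C n N)).
Qed.

Definition slot A m (u : 'I_m -> A) (r : 'I_m) (x : A) : 'I_m -> A :=
  fun r' => if r' == r then x else u r'.

(** Constant decomposable tensors: column vectors fill the contravariant slots and row vectors the
    covariant ones. *)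
Definition pure (u : 'I_p -> 'cV[C]_n) (v : 'I_q -> 'rV[C]_n) : V :=
  fun I J => fps_cst ((\prod_r u r (I r) 0) * (\prod_s v s 0 (J s))).

Lemma pure_slot0l u v r : u r = 0 -> pure u v = 0.
Proof.
move=> ur; apply: tensorP => I J; rewrite /pure (bigD1 r) //= ur mxE !mul0r.
exact: rmorph0.
Qed.

Lemma pure_slot0r u v s : v s = 0 -> pure u v = 0.
Proof.
move=> vs; apply: tensorP => I J; rewrite /pure [X in _ * X](bigD1 s) //= vs mxE mul0r mulr0.
exact: rmorph0.
Qed.

Lemma deriv_mi0 k (f : R) : fps_deriv k f (@mi0 n) = f (mi_unit k).
Proof.
by rewrite /fps_deriv mul1r; congr (f _); apply: funext => i.
Qed.

Lemma cst_deriv (c : C) k (f : R) :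
  flt 1 (fps_cst c * fps_deriv k f - fps_cst (c * f (mi_unit k))).
Proof. by apply/flt1P; rewrite fpsB cstME cst0E deriv_mi0 subrr. Qed.

Lemma sum_prod_upd m (w : 'I_m -> 'I_n -> C) (J : 'I_m -> 'I_n) r (g : 'I_n -> C) :
  \sum_k (\prod_s w s (upd J r k s)) * g k =
  (\sum_k w r k * g k) * \prod_(s | s != r) w s (J s).
Proof.
rewrite mulr_suml; apply: eq_bigr => k _; rewrite (bigD1 r) //= /upd eqxx mulrAC.
by congr (_ * _); apply: eq_bigr => s /negPf ->.
Qed.

(* Modulo the maximal ideal, [lie X] acts as a derivation of the tensor algebra
   through the linear part of [X]. *)
Lemma lie_pure X u v (A := vf_linpart X) :
  fltT 1 (lie X (pure u v) -
    (\sum_s pure u (slot v s (v s *m A)) - \sum_r pure (slot u r (A *m u r)) v)).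
Proof.
have F1 := flt_submod C n 1.
move=> I J; rewrite tenD tenN tenD tenN !ten_sum lieE vf_cst sub0r.
have reorder (a b c d : R) : - a + b - (c - d) = (b - c) + (d - a) by ring.
rewrite reorder -!sumrB.
apply: (submD F1); apply: (subm_sum F1) => r _.
- have -> : pure u (slot v r (v r *m A)) I J
      = \sum_k fps_cst ((\prod_r u r (I r) 0) * \prod_s v s 0 (upd J r k s) * X k (mi_unit (J r))).
    rewrite -(rmorph_sum (@fps_cst C n)) /pure; congr fps_cst.
    under [RHS]eq_bigr => k _ do rewrite -mulrA.
    rewrite -mulr_sumr; congr (_ * _).
    rewrite (sum_prod_upd (fun s => v s 0)) (bigD1 r) //= /slot eqxx mxE; congr (_ * _).
      by apply: eq_bigr => k _; rewrite mxE.
    by apply: eq_bigr => s /negPf ->.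
  by rewrite -sumrB; apply: (subm_sum F1) => k _; exact: cst_deriv.
- have -> : pure (slot u r (A *m u r)) v I J
      = \sum_k fps_cst ((\prod_s u s (upd I r k s) 0) * (\prod_s v s 0 (J s)) * X (I r) (mi_unit k)).
    rewrite -(rmorph_sum (@fps_cst C n)) /pure; congr fps_cst.
    under [RHS]eq_bigr => k _ do rewrite mulrAC.
    rewrite -mulr_suml; congr (_ * _).
    rewrite (sum_prod_upd (fun s i => u s i 0)) (bigD1 r) //= /slot eqxx mxE; congr (_ * _).
      by apply: eq_bigr => k _; rewrite mxE mulrC.
    by apply: eq_bigr => s /negPf ->.
  rewrite -sumrB; apply: (subm_sum F1) => k _; rewrite -opprB; apply: (submN F1).
  exact: cst_deriv.
Qed.

End Lie.
End TensorModule.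

(** * Nilpotency *)

Section Nilpotence.
Variables (C : numClosedFieldType) (n : nat) (D : vfield C n).
Notation R := (fps C n).
Notation cst := (@fps_cst C n).
Hypothesis D1 : forall k, flt 1 (D k).
Hypothesis nilD : exists m, vf_linpart D ^+ m = 0.

Definition lin_row (f : R) : 'rV[C]_n := \row_j f (mi_unit j).

(** Since [D k] vanishes at the origin, only the constant term of each derivative of [f] contributes
    in degree one. *)
Lemma lin_row_vf f : lin_row (vf_apply D f) = lin_row f *m vf_linpart D.
Proof.
apply/rowP => j; rewrite !mxE vf_applyE fps_sum; apply: eq_bigr => k _.
rewrite !mxE -[D k (fun l => _)]/(D k (mi_unit j)).
set g := fps_deriv k f.
have -> : D k * g = D k * (g - cst (g (@mi0 n))) + cst (g (@mi0 n)) * D k.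
  by rewrite mulrBr [cst _ * _]mulrC subrK.
rewrite fpsD cstME (fltM (D1 k) (flt1_cst g)) ?add0r ?mdeg_unit //.
by rewrite /g deriv_mi0.
Qed.

Lemma flt2P f : flt 1 f -> lin_row f = 0 -> flt 2 f.
Proof.
move=> f1 fr al; rewrite ltnS leq_eqVlt => /predU1P[/mdeg_eq1[k ->]|]; last exact: f1.
by have /rowP/(_ k) := fr; rewrite !mxE.
Qed.

(** Modulo order two this is nilpotency of the matrix. Beyond, the Hadamard expansion writes an
    iterate as a sum of [x_k * h_k] with both factors vanishing at the origin, and the Leibniz rule
    gains one order on the induction hypothesis. *)
Lemma vf_nil N (f : R) : flt 1 f -> @geig C R cst R^o (flt N) (vf_apply D) 0 f.
Proof.
have lin := vf_clinear D.
elim: N f => [|[|[|N]] IH] f f1; try by exists 0%N.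
  have [m Dm] := nilD; exists m; rewrite shift0; apply: flt2P.
    exact: (stable_iter m (flt_vf D1 (N := 1))).
  have -> : lin_row (iter m (vf_apply D) f) = lin_row f *m vf_linpart D ^+ m.
    elim: m {Dm} => [|m IHm]; first by rewrite expr0 mulmx1.
    by rewrite iterS lin_row_vf IHm -mulmxA exprSr.
  by rewrite Dm mulmx0.
have FN M := flt_submod C n M.
have [M] := IH f f1; rewrite shift0 => fM.
apply: (@geig_iter _ _ cst R^o _ _ 0 M); rewrite shift0.
have fM2 : flt 2 (iter M (vf_apply D) f) by apply: flt_leq fM.
set h := iter M _ f in fM2 *.
rewrite (hadamardE (flt_leq _ fM2)) //.
apply: (geig_sum lin (FN _) (flt_vf D1 (N := _))) => k _.
have hk1 := flt_hadamard k fM2.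
have [M1] := IH _ (fvar_flt C k); have [M2] := IH _ hk1; rewrite !shift0 => H2 H1.
exists (M1 + M2)%N; rewrite shift0.
apply: (@leibniz_iter R R^o (vf_apply D) (vf_apply D)).
- exact: vfD.
- exact: vfM.
- exact: (submD (FN _)).
- move=> i j ij; have [Mi|iM] := leqP M1 i.
    rewrite -[N.+3]addn1; apply: fltM; last exact: (stable_iter j (flt_vf D1 (N := 1))).
    rewrite -(subnK Mi) iterD; exact: (stable_iter _ (flt_vf D1 (N := _))).
  rewrite -[N.+3]add1n; apply: fltM; first exact: (stable_iter i (flt_vf D1 (N := 1)) (fvar_flt C k)).
  have Mj : (M2 <= j)%N by lia.
  rewrite -(subnK Mj) iterD; exact: (stable_iter _ (flt_vf D1 (N := _))).
Qed.

Section Tensors.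
Variables p q : nat.
Notation V := (tensor C n p q).
Notation A := (vf_linpart D).

Lemma sum_slot_pred m (a : 'I_m -> nat) r : a r != 0%N ->
  (\sum_i slot a r (a r).-1 i < \sum_i a i)%N.
Proof.
move=> ar; rewrite (bigD1 r) //= [X in (_ < X)%N](bigD1 r) //= /slot eqxx.
rewrite (eq_bigr a) => [|i /negPf ->//]; lia.
Qed.

(** Modulo the maximal ideal, [lie D] yields terms in which one slot is multiplied by [A], lowering
    by one the power of [A] that kills it. The sum of these powers bounds the number of
    applications. *)
Lemma pure_nil t (u : 'I_p -> 'cV[C]_n) (v : 'I_q -> 'rV[C]_n) a b :
  (forall r, A ^+ (a r) *m u r = 0) -> (forall s, v s *m A ^+ (b s) = 0) ->
  (\sum_r a r + \sum_s b s < t)%N -> fltT 1 (iter t (lie D) (pure u v)).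
Proof.
have F1 := fltT_submod C n p q 1.
have stab := flt_lie (p := p) (q := q) (N := 1) D1.
elim: t u v a b => // t IH u v a b ua vb lt_t; rewrite iterSr.
have linI := clin_iter (lie_clinear p q D) t.
have pure0 : fltT 1 (iter t (lie D) (0 : V)) by rewrite (clin0 linI); apply: (subm0 F1).
rewrite -(subrK (\sum_s pure u (slot v s (v s *m A)) - \sum_r pure (slot u r (A *m u r)) v)
  (lie D (pure u v))).
rewrite (proj1 linI); apply: (submD F1); first exact: (stable_iter t stab (lie_pure D u v)).
rewrite (clinB linI) !(clin_sum linI); apply: (submB F1); apply: (subm_sum F1).
(* A slot with exponent 0 already holds the zero vector. *)
- move=> s _; have [bs|bs] := eqVneq (b s) 0%N.
    have vs := vb s; rewrite bs expr0 mulmx1 in vs.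
    by rewrite (@pure_slot0r _ _ _ _ _ _ s) // /slot eqxx vs mul0mx.
  apply: (IH _ _ a (slot b s (b s).-1)) => //.
    move=> s'; rewrite /slot; case: eqP => [_|_]; last exact: vb.
    by rewrite -mulmxA -[A *m _]/(A * _) -exprS prednK ?lt0n.
  have := sum_slot_pred bs; lia.
- move=> s _; have [bs|bs] := eqVneq (a s) 0%N.
    have vs := ua s; rewrite bs expr0 mul1mx in vs.
    by rewrite (@pure_slot0l _ _ _ _ _ _ s) // /slot eqxx vs mulmx0.
  apply: (IH _ _ (slot a s (a s).-1) b) => //.
    move=> s'; rewrite /slot; case: eqP => [_|_]; last exact: ua.
    by rewrite mulmxA -[_ *m A]/(_ * A) -exprSr prednK ?lt0n.
  have := sum_slot_pred bs; lia.
Qed.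

Lemma pure_geig u v : @geig C R cst V (fltT 1) (lie D) 0 (pure u v).
Proof.
have [m Am] := nilD; exists (\sum_(r < p) m + \sum_(s < q) m).+1%N; rewrite shift0.
apply: (@pure_nil _ u v (fun _ => m) (fun _ => m)) => // s; by rewrite Am ?mul0mx ?mulmx0.
Qed.

End Tensors.
End Nilpotence.

(** * Expansion in constant basis tensors *)

Section TensorBasis.
Variables (C : numClosedFieldType) (n p q : nat).
Notation V := (tensor C n p q).
Notation cst := (@fps_cst C n).

Definition ten_basis (I : {ffun 'I_p -> 'I_n}) (J : {ffun 'I_q -> 'I_n}) : V :=
  pure (fun r => delta_mx (I r) 0) (fun s => delta_mx 0 (J s)).

Lemma ten_basis_diag I' J' : ten_basis (finfun I') (finfun J') I' J' = 1.
Proof.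
rewrite /ten_basis /pure -(rmorph1 cst); congr fps_cst.
by rewrite !big1 ?mulr1 // => r _; rewrite mxE ffunE !eqxx.
Qed.

Lemma ten_basis_off I J I' J' : (I != finfun I') || (J != finfun J') ->
  ten_basis I J I' J' = 0.
Proof.
rewrite /ten_basis /pure -(rmorph0 cst) => IJ; congr fps_cst; apply/eqP.
rewrite mulf_eq0; case/orP: IJ => ne; apply/orP; [left|right]; apply/prodf_eq0.
  have [r ner|eI] := pickP (fun r => I r != I' r).
    by exists r => //; rewrite mxE (eq_sym (I' r)) (negPf ner).
  by case/eqP: ne; apply/ffunP => r; rewrite ffunE; move/negbFE/eqP: (eI r).
have [r ner|eJ] := pickP (fun r => J r != J' r).
  by exists r => //; rewrite mxE (eq_sym (J' r)) (negPf ner) andbF.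
by case/eqP: ne; apply/ffunP => r; rewrite ffunE; move/negbFE/eqP: (eJ r).
Qed.

Lemma ten_expand (T : V) : T = \sum_(I : {ffun 'I_p -> 'I_n})
  \sum_(J : {ffun 'I_q -> 'I_n}) T I J *: ten_basis I J.
Proof.
apply: tensorP => I' J'; rewrite ten_sum.
have fE m (K : 'I_m -> 'I_n) : fun_of_fin (finfun K) = K by apply: funext => i; rewrite ffunE.
rewrite (bigD1 (finfun I')) //= [X in _ + X]big1 ?addr0 => [|I neI]; last first.
  by rewrite ten_sum big1 // => J _; rewrite tenZ ten_basis_off ?neI // mulr0.
rewrite ten_sum (bigD1 (finfun J')) //= [X in _ + X]big1 ?addr0 => [|J neJ]; last first.
  by rewrite tenZ ten_basis_off ?neJ ?orbT // mulr0.
by rewrite tenZ ten_basis_diag mulr1 !fE.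
Qed.

End TensorBasis.

Section TensorNilpotence.
Variables (C : numClosedFieldType) (n p q : nat) (D : vfield C n).
Notation R := (fps C n).
Notation V := (tensor C n p q).
Notation cst := (@fps_cst C n).
Hypothesis D1 : forall k, flt 1 (D k).
Hypothesis nilD : exists m, vf_linpart D ^+ m = 0.

(** Modulo order one, only the constant part matters, and it is a combination of decomposable
    tensors. Higher up, an iterate is a sum of [x_k] times tensors; nilpotency is applied to [x_k]
    and, one order lower, to the tensors. *)
Lemma lie_nil N (T : V) : @geig C R cst V (fltT N) (lie D) 0 T.
Proof.
have lin := lie_clinear p q D.
have FN M := fltT_submod C n p q M.
elim: N T => [|[|N] IH] T; first by exists 0%N.
  have {1}-> : T = (\sum_(I : {ffun 'I_p -> 'I_n}) \sum_(J : {ffun 'I_q -> 'I_n})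
    cst (T I J (@mi0 n)) *: ten_basis C I J) + (T - \sum_(I : {ffun 'I_p -> 'I_n})
    \sum_(J : {ffun 'I_q -> 'I_n}) cst (T I J (@mi0 n)) *: ten_basis C I J).
    by rewrite addrC subrK.
  apply: (geigD lin (FN _) (flt_lie (p := p) (q := q) D1)).
    apply: (geig_sum lin (FN _) (flt_lie (p := p) (q := q) D1)) => I _.
    apply: (geig_sum lin (FN _) (flt_lie (p := p) (q := q) D1)) => J _.
    rewrite -(actCp cst (lie D)); apply: (geig_act lin (FN _) (flt_lie (p := p) (q := q) D1)).
    exact: pure_geig.
  apply: geig_flt; rewrite {1}[T]ten_expand -sumrB; apply: (subm_sum (FN _)) => I _.
  rewrite -sumrB; apply: (subm_sum (FN _)) => J _; rewrite -scalerBl.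
  by apply: (@fltTZ _ _ _ _ 1 0) => //; apply: flt1_cst.
have [M] := IH T; rewrite shift0 => fM.
apply: (@geig_iter _ _ cst V _ _ 0 M); rewrite shift0.
have fM1 I J : flt 1 (iter M (lie D) T I J) by apply: flt_leq (fM I J).
set h := iter M _ T in fM1 *.
have -> : h = \sum_k fvar C k *: ((fun I J => hadamard k (h I J)) : V).
  by apply: tensorP => I J; rewrite ten_sum {1}(hadamardE (fM1 I J)).
apply: (geig_sum lin (FN _) (flt_lie (p := p) (q := q) D1)) => k _.
set w : V := fun I J => _.
have [M1] := vf_nil D1 nilD N.+2 (fvar_flt C k); have [M2] := IH w; rewrite !shift0 => H2 H1.
exists (M1 + M2)%N; rewrite shift0.
apply: (@leibniz_iter R V (vf_apply D) (lie D)).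
- exact: lieD.
- exact: lieZ.
- exact: (submD (FN _)).
- move=> i j ij; have [Mi|iM] := leqP M1 i.
    rewrite -[N.+2]addn0; apply: fltTZ => //.
    rewrite -(subnK Mi) iterD; exact: (stable_iter _ (flt_vf D1 (N := _))).
  apply: (@fltTZ _ _ _ _ 1 N.+1); first exact: (stable_iter i (flt_vf D1 (N := 1)) (fvar_flt C k)).
  have Mj : (M2 <= j)%N by lia.
  rewrite -(subnK Mj) iterD; exact: (stable_iter _ (flt_lie (p := p) (q := q) D1)).
Qed.

End TensorNilpotence.

(** * Normal forms *)

Section DiagonalFields.
Variables (C : numClosedFieldType) (n p q : nat) (gamma : 'I_n -> C).
Notation R := (fps C n).
Notation V := (tensor C n p q).
Notation cst := (@fps_cst C n).
Notation S := (diag_vf gamma).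

(** [dx_j] has weight [gamma j], and [d/dx_i] has weight [- gamma i]. *)
Definition ten_weight (I : 'I_p -> 'I_n) (J : 'I_q -> 'I_n) : C :=
  \sum_s gamma (J s) - \sum_r gamma (I r).

Lemma upd_id m (I : 'I_m -> 'I_n) r : upd I r (I r) = I.
Proof. by apply: funext => i; rewrite /upd; case: eqP => [->|]. Qed.

Lemma deriv_diag k i : fps_deriv k (S i) = cst (gamma i) * (k == i)%:R.
Proof. by rewrite /diag_vf fps_lin_var fps_derivZ fps_deriv_var. Qed.

Lemma vf_diag_comp (Y : vfield C n) k : vf_apply Y (S k) = cst (gamma k) * Y k.
Proof.
rewrite vf_applyE (bigD1 k) //= big1 => [|i /negPf ne]; last by rewrite deriv_diag ne !mulr0.
by rewrite deriv_diag eqxx mulr1 addr0 mulrC.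
Qed.

Lemma lie_diag (T : V) I J :
  lie S T I J = vf_apply S (T I J) + cst (ten_weight I J) * T I J.
Proof.
rewrite lieE -addrA; congr (_ + _).
rewrite /ten_weight rmorphB !rmorph_sum mulrBl addrC !mulr_suml; congr (_ - _).
  apply: eq_bigr => s _; rewrite (bigD1 (J s)) //= big1 ?addr0 => [|k /negPf ne].
    by rewrite upd_id deriv_diag eqxx mulr1 mulrC.
  by rewrite deriv_diag eq_sym ne !mulr0.
apply: eq_bigr => r _; rewrite (bigD1 (I r)) //= big1 ?addr0 => [|k /negPf ne].
  by rewrite upd_id deriv_diag eqxx mulr1 mulrC.
by rewrite deriv_diag ne !mulr0.
Qed.

Lemma lie_diag_basis I J :
  lie S (ten_basis C I J) = cst (ten_weight I J) *: ten_basis C I J.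
Proof.
apply: tensorP => I' J'; rewrite lie_diag tenZ.
have [/andP[/eqP -> /eqP ->]|ne] := boolP ((I == finfun I') && (J == finfun J')).
  have fE m (K : 'I_m -> 'I_n) : fun_of_fin (finfun K) = K by apply: funext => i; rewrite ffunE.
  by rewrite ten_basis_diag -(rmorph1 cst) vf_cst add0r !fE.
by rewrite ten_basis_off -?negb_and // -(rmorph0 cst) vf_cst rmorph0 !mulr0 addr0.
Qed.

Lemma vf_diag_deriv k f :
  vf_apply S (fps_deriv k f) = fps_deriv k (vf_apply S f) - cst (gamma k) * fps_deriv k f.
Proof.
apply: fpsP => al; rewrite fpsB cstME vf_diag /fps_deriv vf_diag.
have -> : \sum_j gamma j * (mi_inc al k j)%:R = \sum_j gamma j * (al j)%:R + gamma k.
  rewrite [LHS](bigD1 k) //= [X in _ = X + _](bigD1 k) //= /mi_inc eqxx.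
  rewrite (eq_bigr (fun j => gamma j * (al j)%:R)) => [|j /negPf -> //].
  by rewrite -natr1; ring.
by ring.
Qed.

Variable D : vfield C n.
Hypothesis eigD : forall k, vf_apply S (D k) = cst (gamma k) * D k.

Lemma vf_diag_comm f : vf_apply S (vf_apply D f) = vf_apply D (vf_apply S f).
Proof.
rewrite (vf_applyE D) (clin_sum (vf_clinear S)) (vf_applyE D); apply: eq_bigr => k _.
by rewrite vfM eigD vf_diag_deriv; ring.
Qed.

Lemma vf_diag_jac i k : vf_apply S (fps_deriv k (D i)) =
  (cst (gamma i) - cst (gamma k)) * fps_deriv k (D i).
Proof. by rewrite vf_diag_deriv eigD fps_derivZ mulrBl. Qed.

Lemma ten_weight_updl I J r k :
  ten_weight (upd I r k) J = ten_weight I J + gamma (I r) - gamma k.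
Proof.
rewrite /ten_weight (bigD1 r) //= [X in _ = _ - X + _ - _](bigD1 r) //= /upd eqxx.
rewrite (eq_bigr (fun i => gamma (I i))) => [|i /negPf -> //]; ring.
Qed.

Lemma ten_weight_updr I J s k :
  ten_weight I (upd J s k) = ten_weight I J - gamma (J s) + gamma k.
Proof.
rewrite /ten_weight (bigD1 s) //= [X in _ = X - _ - _ + _](bigD1 s) //= /upd eqxx.
rewrite (eq_bigr (fun i => gamma (J i))) => [|i /negPf -> //]; ring.
Qed.

Lemma fps_cstD (a b : C) : cst (a + b) = cst a + cst b.
Proof. exact: rmorphD. Qed.

Lemma fps_cstB (a b : C) : cst (a - b) = cst a - cst b.
Proof. exact: rmorphB. Qed.

(** [eigD] expresses that the bracket of [S] with [D] vanishes. The derivative of [D i] in [x_k]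
    then has weight [gamma i - gamma k], which accounts exactly for the change of tensor weight when
    an index is replaced. *)
Lemma lie_diag_comm (T : V) : lie S (lie D T) = lie D (lie S T).
Proof.
apply: tensorP => I J; rewrite lie_diag !(lieE D).
have linS := vf_clinear S.
rewrite (proj1 linS) (clinB linS) !(clin_sum linS) mulrDr mulrBr !mulr_sumr.
have reorder (a b c d e f : R) : a - b + c + (d - e + f) = (a + d) - (b + e) + (c + f) by ring.
rewrite reorder -!big_split /=; congr (_ - _ + _).
- by rewrite lie_diag vfD vfM vf_cst vf_diag_comm mul0r add0r.
- apply: eq_bigr => r _; rewrite (clin_sum linS) mulr_sumr -big_split /=.
  apply: eq_bigr => k _; rewrite lie_diag vfM vf_diag_jac ten_weight_updl.
  by rewrite fps_cstB fps_cstD; ring.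
- apply: eq_bigr => s _; rewrite (clin_sum linS) mulr_sumr -big_split /=.
  apply: eq_bigr => k _; rewrite lie_diag vfM vf_diag_jac ten_weight_updr.
  by rewrite fps_cstD fps_cstB; ring.
Qed.

End DiagonalFields.

(** * Lie derivatives along a field in normal form *)

Section NormalForm.
Variables (C : numClosedFieldType) (n : nat) (X : vfield C n) (gamma beta : 'I_n -> C).
Notation R := (fps C n).
Notation cst := (@fps_cst C n).
Notation S := (diag_vf gamma).
Notation Z := (diag_vf beta).
Hypothesis X1 : vf_vanishes X.
Hypothesis nilX : exists m, (vf_linpart X - diag_mx (\row_j gamma j)) ^+ m = 0.
Hypothesis eigX : forall k, vf_apply S (X k) = cst (gamma k) * X k.

(** Contains [X^n] and all the nonlinear terms: it commutes with [S], and its linear part is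
    nilpotent. *)
Definition nil_part : vfield C n := fun k => X k - S k.
Notation D := nil_part.

Lemma flt_X k : flt 1 (X k).
Proof. by apply/flt1P; apply: X1. Qed.

Lemma flt_D k : flt 1 (D k).
Proof.
apply: (submB (flt_submod C n 1) (flt_X k)); rewrite /diag_vf fps_lin_var.
exact/(submZ (flt_submod C n 1))/fvar_flt.
Qed.

Lemma linpart_D : vf_linpart D = vf_linpart X - diag_mx (\row_j gamma j).
Proof.
apply/matrixP => i j; rewrite !mxE /nil_part fpsB -[fun l => _]/(mi_unit j) /diag_vf fps_linE.
congr (_ - _); case: mi_eqP => [/(congr1 (@^~ j))|ne].
  by rewrite /mi_unit eqxx; case: (eqVneq i j).
by case: (eqVneq i j) ne => // -> [].
Qed.

Lemma nil_D : exists m, vf_linpart D ^+ m = 0.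
Proof. by rewrite linpart_D. Qed.

Lemma eig_D k : vf_apply S (D k) = cst (gamma k) * D k.
Proof.
by rewrite (clinB (vf_clinear S)) eigX mulrBr vf_diag_comp.
Qed.

Lemma vf_split f : vf_apply X f = vf_apply S f + vf_apply D f.
Proof.
rewrite !vf_applyE -big_split; apply: eq_bigr => k _ /=.
by rewrite -mulrDl addrC subrK.
Qed.

Lemma lie_split p q (T : tensor C n p q) : lie X T = lie S T + lie D T.
Proof.
have XE k : X k = S k + D k by rewrite addrC subrK.
apply: tensorP => I J; rewrite tenD !lieE vf_split.
under eq_bigr => r _ do under eq_bigr => k _ do rewrite XE fps_derivD mulrDr.
under eq_bigr => r _ do rewrite big_split.
under [X in _ + X = _]eq_bigr => r _ do under eq_bigr => k _ do rewrite XE fps_derivD mulrDr.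
under [X in _ + X = _]eq_bigr => r _ do rewrite big_split.
rewrite !big_split /=; ring.
Qed.

Lemma vf_shift l f : vf_apply S f = cst l * f ->
  forall m, iter m (@shift C R cst R^o (vf_apply X) l) f = iter m (vf_apply D) f.
Proof.
apply: (@shift_eigen C R cst R^o); [exact: vf_split | exact: vf_diag_comm eig_D | exact: vf_clinear].
Qed.

Lemma lie_shift p q l (T : tensor C n p q) : lie S T = cst l *: T ->
  forall m, iter m (shift cst (lie X) l) T = iter m (lie D) T.
Proof.
apply: (@shift_eigen C R cst); [exact: lie_split | exact: lie_diag_comm eig_D | exact: lie_clinear].
Qed.

(** [K0] pairs a weight for [S] with the matching weight for [Z]; the pairs form an additive group
    containing each [(gamma j, beta j)]. *)
Variable K0 : C -> C -> Prop.
Hypothesis K00 : K0 0 0.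
Hypothesis K0D : forall l k m h, K0 l k -> K0 m h -> K0 (l + m) (k + h).
Hypothesis K0N : forall l k, K0 l k -> K0 (- l) (- k).
Hypothesis K0g : forall j, K0 (gamma j) (beta j).

Lemma K0_sum A (r : seq A) (P : pred A) (E F : A -> C) :
  (forall i, K0 (E i) (F i)) -> K0 (\sum_(i <- r | P i) E i) (\sum_(i <- r | P i) F i).
Proof. by move=> EF; elim/big_rec2: _ => // i x y _; apply: K0D. Qed.

Lemma K0_mono b : K0 (\sum_j gamma j * (b j)%:R) (\sum_j beta j * (b j)%:R).
Proof.
apply: K0_sum => j; elim: (b j) => [|m IH]; first by rewrite !mulr0.
by rewrite -natr1 !mulrDr !mulr1; apply: K0D.
Qed.

(** One application of [D] makes any series vanish at the origin, which brings it under [vf_nil]. *)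
Lemma vf_nil_all N (f : R) : @geig C R cst R^o (flt N) (vf_apply D) 0 f.
Proof.
apply: (@geig_iter _ _ cst R^o _ _ 0 1); rewrite shift0 /=.
apply: (vf_nil flt_D nil_D); rewrite vf_applyE.
apply: (subm_sum (flt_submod C n 1)) => k _; rewrite mulrC.
exact: (submZ (flt_submod C n 1)) (flt_D k).
Qed.

(** Modulo order [N] a series is a finite sum of monomials. Each is an eigenvector of [S] and of
    [Z], and a generalized eigenvector of [X] because [X - l] iterates on it as the nilpotent
    [D]. *)
Lemma ss_vf N (f : R) :
  @ss_action C R cst R^o (flt N) (vf_apply X) K0 f (vf_apply Z f).
Proof.
rewrite (_ : f = f - trunc_sum N f + trunc_sum N f); last by rewrite subrK.
rewrite vfD.
have Z1 k : flt 1 (Z k).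
  rewrite /diag_vf fps_lin_var; exact/(submZ (flt_submod C n 1))/fvar_flt.
apply: SsAdd; first by apply: SsFlt; [|apply: (flt_vf Z1)]; apply: flt_trunc.
rewrite (clin_sum (vf_clinear Z)).
apply: (ss_sum (flt_submod C n N)) => b _.
have wS : vf_apply S (cst (f (mi_of b)) * mono C (mi_of b)) =
    cst (\sum_j gamma j * (mi_of b j)%:R) * (cst (f (mi_of b)) * mono C (mi_of b)).
  by rewrite vfM vf_cst mul0r add0r vf_diag_mono mulrCA.
have -> : vf_apply Z (cst (f (mi_of b)) * mono C (mi_of b)) =
    cst (\sum_j beta j * (mi_of b j)%:R) * (cst (f (mi_of b)) * mono C (mi_of b)).
  by rewrite vfM vf_cst mul0r add0r vf_diag_mono mulrCA.
apply: SsGeig (K0_mono _) _.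
have [M] := vf_nil_all N (cst (f (mi_of b)) * mono C (mi_of b)); rewrite shift0 => HM.
by exists M; rewrite (vf_shift wS).
Qed.

Lemma K0_weight p q (I : 'I_p -> 'I_n) (J : 'I_q -> 'I_n) :
  K0 (ten_weight gamma I J) (ten_weight beta I J).
Proof. by apply: K0D; [|apply: K0N]; apply: K0_sum. Qed.

(** Coefficients are covered by [ss_vf] and constant basis tensors are weight vectors; [ssZ]
    combines the two. *)
Lemma ss_lie p q N (T : tensor C n p q) :
  ss_action cst (fltT N) (lie X) K0 T (lie Z T).
Proof.
rewrite {2}[T]ten_expand {1}[T]ten_expand.
rewrite (clin_sum (lie_clinear p q Z)); apply: (ss_sum (fltT_submod C n p q N)) => I _.
rewrite (clin_sum (lie_clinear p q Z)); apply: (ss_sum (fltT_submod C n p q N)) => J _.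
rewrite lieZ; apply: (@ssZ C R cst _ (vf_apply X) (lie X) (lie X) (flt N) (fltT N)).
- exact: lie_clinear.
- exact: lieZ.
- exact: flt_submod.
- exact: fltT_submod.
- exact: (flt_vf flt_X).
- exact: (flt_lie flt_X).
- by move=> a v aN; rewrite -[N]addn0; apply: fltTZ.
- exact: K0D.
- exact: ss_vf.
rewrite lie_diag_basis; apply: SsGeig (K0_weight _ _) _.
have [M] := lie_nil flt_D nil_D N (ten_basis C I J); rewrite shift0 => HM.
by exists M; rewrite (lie_shift (lie_diag_basis _ _ _)).
Qed.

(** * The operator [X - g] on functions, and relative invariants *)

Section Twist.
Variables (g : R) (d : C).
Notation c := (g (@mi0 n)).

Definition twist (a : R) : R := vf_apply X a - g * a.

Lemma twist_clinear : @clinear C R cst R^o twist.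
Proof.
split=> [a b|l a]; rewrite /twist; first by rewrite vfD mulrDr opprD addrACA.
by rewrite (proj2 (vf_clinear X)) -[_ *: a]/(_ * a) -[_ *: _]/(_ * _) mulrCA -mulrBr.
Qed.

Lemma flt_twist N : @stable R R^o (flt N) twist.
Proof.
move=> a aN; apply: (submB (flt_submod C n N)); first exact: flt_vf flt_X _ _.
exact: (submZ (flt_submod C n N) g).
Qed.

(* The eigenvalues of [twist] are those of [X] lowered by [g(0)]; the shift [d]
   is forced by consistency when [g(0)] is itself a difference of weights. *)
Definition twist_rel l k := K0 (l + c) (k + d).

(** Multiplication by [g - g(0)] raises the order by one; up to that order [twist - (l - c)] behaves
    on weight vectors as [D]. *)
Lemma twist_shift N l (v : R) : vf_apply S v = cst l * v -> flt N v ->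
  forall m, flt N.+1 (iter m (@shift C R cst R^o twist (l - c)) v - iter m (vf_apply D) v).
Proof.
move=> wv vN; set sh := shift _ _ _.
have FN M := flt_submod C n M.
have shN : @stable R R^o (flt N) sh.
  exact: (@stable_shift C R cst R^o _ (FN N) twist (l - c) (@flt_twist N)).
have shE (w : R) : sh w = @shift C R cst R^o (vf_apply X) l w - (g - cst c) * w.
  have e (Y : R -> R) m : @shift C R cst R^o Y m w = Y w - cst m * w by [].
  by rewrite /sh !e /twist fps_cstB; ring.
elim=> [|m IH]; first by rewrite subrr => al.
rewrite !iterS shE.
have := vf_shift wv m.+1; rewrite !iterS (vf_shift wv) => <-.
rewrite addrAC -(clinB (clin_shift (vf_clinear X) l)).
apply: (submB (FN _)).
  exact: (@stable_shift C R cst R^o _ (FN _) (vf_apply X) l (flt_vf flt_X (N := _))).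
rewrite -[N.+1]add1n; apply: fltM (flt1_cst g) _; exact: (stable_iter m shN).
Qed.

(** Induction from high order to low. Iterating its shifted operator pushes a monomial one order up,
    where it is decomposable by induction; [ss_unshift_iter] brings the decomposition back. *)
Lemma twist_decomp N m (a : R) : flt (N - m) a ->
  exists z, @ss_action C R cst R^o (flt N) twist twist_rel a z.
Proof.
have FN M := flt_submod C n M.
have ssF (u w : R) : flt N u -> flt N w -> @ss_action C R cst R^o (flt N) twist twist_rel u w.
  exact: SsFlt.
elim: m a => [|m IH] a; first by rewrite subn0 => aN; exists 0; apply: ssF.
(* When [N <= m] both truncated differences are 0 and the order condition is void. *)
have [Nm|mN] := leqP N m; first by move=> _; apply: IH; rewrite (eqP Nm).
set e := (N - m.+1)%N => ae.
have eS : (N - m)%N = e.+1 by rewrite /e; lia.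
have term (b : {ffun 'I_n -> 'I_e.+2}) : exists z,
    @ss_action C R cst R^o (flt N) twist twist_rel (cst (a (mi_of b)) * mono C (mi_of b)) z.
  pose v : R := cst (a (mi_of b)) * mono C (mi_of b); rewrite -/v.
  have ve : flt e v.
    move=> al ale; rewrite /v cstME /mono; case: mi_eqP => [<-|]; last by rewrite mulr0.
    by rewrite ae ?mul0r.
  have wv : vf_apply S v = cst (\sum_j gamma j * (mi_of b j)%:R) * v.
    by rewrite /v vfM vf_cst mul0r add0r vf_diag_mono mulrCA.
  have [M] := vf_nil_all (N - m) v; rewrite shift0 => HM.
  have [|z Hz] := IH (iter M (@shift C R cst R^o twist (\sum_j gamma j * (mi_of b j)%:R - c)) v).
    rewrite -[iter M _ v](subrK (iter M (vf_apply D) v)); apply: (submD (FN _)) HM.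
    by rewrite eS; apply: twist_shift.
  have rel_b : twist_rel (\sum_j gamma j * (mi_of b j)%:R - c) (\sum_j beta j * (mi_of b j)%:R - d).
    by rewrite /twist_rel !subrK; apply: K0_mono.
  exact: (ss_unshift_iter twist_clinear (FN N) (@flt_twist N) rel_b Hz).
have [z Hz] := choice term.
have [|z' Hz'] := IH (a - trunc_sum e.+1 a); first by rewrite eS; apply: flt_trunc.
exists (z' + \sum_b z b); rewrite -{1}[a](subrK (trunc_sum e.+1 a)).
by apply: SsAdd Hz' _; apply: (ss_sum (FN N)) => b _; apply: Hz.
Qed.

Lemma twist_one N : exists z, @ss_action C R cst R^o (flt N) twist twist_rel (1 : R) z.
Proof. by apply: (@twist_decomp N N); rewrite subnn. Qed.

Variables (p q : nat) (f : R) (T : tensor C n p q).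
Hypothesis f0 : f != 0.
Hypothesis XT : f *: lie X T - vf_apply X f *: T = (f * g) *: T.
Hypothesis funK0 : forall l k k', K0 l k -> K0 l k' -> k = k'.
Hypothesis dP : forall h, K0 c h -> h = d.

Lemma twist_rel_fun l k k' : twist_rel l k -> twist_rel l k' -> k = k'.
Proof. by move=> H /(funK0 H)/addIr. Qed.

(** A common eigenvalue [l] makes [c] a difference of weights; [dP] then identifies its [Z]-weight
    with [d], exactly the offset in [twist_rel]. *)
Lemma K01_fun l k k' : K0 l k -> twist_rel l k' -> k = k'.
Proof.
move=> H H'; have := K0D H' (K0N H); rewrite addrAC subrr add0r => /dP.
by move/(congr1 (fun x => x - d + k)); rewrite subrr add0r => <-; ring.
Qed.

(** Writing [T] as [1 *: T], the Leibniz rule for [Y = L_X - g] puts the twist on the factor [1] and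
    leaves [L_X] on [T]; [ss_ratio] then compares the result with [f]. *)
Lemma twist_ratio N z : @ss_action C R cst R^o (flt N) twist twist_rel (1 : R) z ->
  fltT N (f *: (z *: T + lie Z T) - vf_apply Z f *: T).
Proof.
move=> Hz; pose Y (U : tensor C n p q) := lie X U - g *: U.
have linY : clinear cst Y.
  split=> [U W|l U]; rewrite /Y; first by rewrite lieD scalerDr opprD addrACA.
  by rewrite (proj2 (lie_clinear p q X)) scalerBr !scalerA mulrC.
have FN := flt_submod C n N; have FTN := fltT_submod C n p q N.
have stY : stable (fltT N) Y.
  by move=> U UN; apply: (submB FTN); [apply: flt_lie flt_X _ _ | apply: (submZ FTN)].
have FRF (a : R) (U : tensor C n p q) : flt N a -> fltT N (a *: U).
  by move=> aN; rewrite -[N]addn0; apply: fltTZ.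
(* The union lets one polynomial serve [f] under [X] and [T] under [Y]. *)
pose K l k := K0 l k \/ twist_rel l k.
have ssf : @ss_action C R cst R^o (flt N) (vf_apply X) K f (vf_apply Z f).
  by apply: ss_mono (ss_vf N f) => l k; left.
have ssT : ss_action cst (fltT N) Y K T (z *: T + lie Z T).
  apply: (@ss_mono C R cst _ Y (fltT N) twist_rel) => [l k|]; first by right.
  rewrite -{1}[T]scale1r -[lie Z T]scale1r.
  apply: (@ssZ C R cst _ twist (lie X) Y (flt N) (fltT N) linY _ FN FTN (@flt_twist N)
    (flt_lie flt_X (N := N)) FRF twist_rel K0 twist_rel) Hz (ss_lie N T).
    by move=> a v; rewrite /Y /twist lieZ scalerBl !scalerA addrAC.
  by move=> l k m h; rewrite /twist_rel addrAC [k + h + d]addrAC; apply: K0D.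
apply: (ss_ratio (vf_clinear X) linY _ _ _ FN FTN (flt_vf flt_X (N := N)) stY FRF _ ssf ssT).
- by move=> a v; rewrite /Y lieZ scalerBr !scalerA addrA [a * g]mulrC.
- move=> U fU; apply: tensorP => I J; apply/eqP; move/(congr1 (fun W : tensor C n p q => W I J)): fU.
  rewrite tenZ => /eqP; apply: contraLR; exact: fpsM_neq0.
- by rewrite /Y scalerBr scalerA -XT opprB addrC subrK.
- move=> l k k' [H|H] [H'|H'].
  + exact: funK0 H H'.
  + exact: K01_fun H H'.
  + by rewrite (K01_fun H' H).
  + exact: twist_rel_fun H H'.
Qed.

(** By uniqueness the functions [z N] are compatible under truncation, hence have a limit [h]; the
    identity, true modulo every order, holds exactly. *)
Lemma twist_lim : exists h : R, f *: lie Z T - vf_apply Z f *: T = (f * h) *: T.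
Proof.
have [z Hz] := choice twist_one.
(* The coefficient at [al] is stable once the order exceeds its degree. *)
pose h : R := fun al => z (mdeg al).+1 al.
have hz N : flt N (z N - h).
  move=> al alN; have : flt (mdeg al).+1 (z (mdeg al).+1 - z N).
    apply: (ss_uniq twist_clinear twist_rel_fun (flt_submod C n _) (@flt_twist _)
      (flt_submod C n _) (@flt_twist _) _ (Hz _) (Hz N)).
    by move=> v; apply: flt_leq.
  by move=> /(_ al (ltnSn _)); rewrite !fpsB => e; rewrite /h -opprB e oppr0.
exists (- h); apply/eqP; rewrite -subr_eq0; apply/eqP; apply: tensorP => I J.
apply: flt_all => N.
rewrite tenD tenN tenD tenN !tenZ.
have -> : f * lie Z T I J - vf_apply Z f * T I J - f * - h * T I J =
    (f * (z N * T I J + lie Z T I J) - vf_apply Z f * T I J) - f * T I J * (z N - h).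
  by ring.
apply: (submB (flt_submod C n N)); first exact: (twist_ratio (Hz N) I J).
exact/(submZ (flt_submod C n N))/hz.
Qed.

End Twist.

(** Since [X] kills [1], the correction term is 0 when [g = 0]; this is what separates (i) from
    (ii). *)
Lemma untwisted_one N : @ss_action C R cst R^o (flt N) (twist 0) (twist_rel 0 0) (1 : R) 0.
Proof.
have := @SsGeig C R cst R^o (flt N) (twist 0) (twist_rel 0 0) 0 0 (1 : R).
rewrite rmorph0 scale0r; apply; first by rewrite /twist_rel !addr0.
exists 1%N; rewrite shift0 /= /twist -(rmorph1 cst) vf_cst mul0r subrr.
by move=> al.
Qed.

End NormalForm.

(** * Rational tensor fields as fractions *)

Section RationalTensors.
Variables (C : numClosedFieldType) (n p q : nat) (X : vfield C n) (L : rtensor C n p q).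

Lemma rt_lie_zero : rt_eq (rt_lie X L) (rt_zero C n p q) <->
  L.2 *: lie X L.1 - vf_apply X L.2 *: L.1 = 0.
Proof.
split=> [H|H I J al].
  apply: tensorP => I J; apply: fpsP => al; have := H I J al.
  by rewrite !fps_mulrE mul1r [X in _ = X al]mulr0.
change ((1 * (L.2 *: lie X L.1 - vf_apply X L.2 *: L.1) I J) al = (L.2 * L.2 * 0) al).
by rewrite H mul1r mulr0.
Qed.

(** Cross multiplication leaves an extra factor [L.2] on both sides; it cancels because power series
    form a domain. *)
Lemma rt_lie_scale g : rt_wf L -> rt_eq (rt_lie X L) (rt_scale g L) <->
  L.2 *: lie X L.1 - vf_apply X L.2 *: L.1 = (L.2 * g) *: L.1.
Proof.
move=> [al0 /eqP fal0]; have f0 : L.2 != 0 by apply/eqP => f0; apply: fal0; rewrite f0.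
pose W := L.2 *: lie X L.1 - vf_apply X L.2 *: L.1.
split=> [H|H I J al]; last first.
  change ((L.2 * W I J) al = (L.2 * L.2 * (g * L.1 I J)) al).
  by rewrite [W]H tenZ !mulrA.
apply: tensorP => I J.
have e : L.2 * (W I J - (L.2 * g) * L.1 I J) = 0.
  rewrite mulrBr; apply/eqP; rewrite subr_eq0; apply/eqP; apply: fpsP => al.
  by rewrite !mulrA -[L.2 * L.2 * g * _]mulrA; exact: (H I J al).
apply/eqP; rewrite -subr_eq0; apply: contra_eqT e; exact: fpsM_neq0.
Qed.

End RationalTensors.

(** * Weights in the span of incommensurable numbers *)

Section Weights.
Variables (C : numClosedFieldType) (tau : nat) (rho : 'I_tau -> C) (k0 : 'I_tau).

(* Pairs (weight for [X^s], weight for [Z_k0]) of a vector with multiweight [w]. *)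
Definition weight_rel (l k : C) := exists w : 'I_tau -> int,
  l = \sum_i rho i * (w i)%:~R /\ k = (w k0)%:~R.

Lemma weight_rel0 : weight_rel 0 0.
Proof.
by exists (fun _ => 0); split=> //; rewrite big1 // => i _; rewrite mulr0.
Qed.

Lemma weight_relD l k m h : weight_rel l k -> weight_rel m h -> weight_rel (l + m) (k + h).
Proof.
move=> [w [-> ->]] [v [-> ->]]; exists (fun i => w i + v i); rewrite rmorphD; split=> //.
by rewrite -big_split; apply: eq_bigr => i _; rewrite rmorphD mulrDr.
Qed.

Lemma weight_relN l k : weight_rel l k -> weight_rel (- l) (- k).
Proof.
move=> [w [-> ->]]; exists (fun i => - w i); rewrite rmorphN; split=> //.
by rewrite -sumrN; apply: eq_bigr => i _; rewrite rmorphN mulrN.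
Qed.

(** Incommensurability enters here: the integer coordinates of a weight with respect to the [rho i]
    are unique. *)
Lemma weight_rel_fun : incommensurable rho ->
  forall l k k', weight_rel l k -> weight_rel l k' -> k = k'.
Proof.
move=> inc l k k' [w [-> ->]] [w' [e ->]]; congr intr; apply/eqP; rewrite -subr_eq0.
rewrite -(intr_eq0 rat); apply/eqP; apply: (inc (fun i => (w i - w' i)%:~R)).
under eq_bigr => i _ do rewrite ratr_int mulrC rmorphB mulrBr.
by rewrite sumrB e subrr.
Qed.

End Weights.

Theorem theorem2p3 (C : numClosedFieldType) (n : nat) (X : vfield C n)
  (gamma : 'I_n -> C) (tau : nat) (rho : 'I_tau -> C) (a : 'I_tau -> 'I_n -> int)
  (p q : nat) (Lam : rtensor C n p q) :
  vf_vanishes X ->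
  (* Jordan decomposition of the linear part with diagonal semisimple part *)
  (let N := vf_linpart X - diag_mx (\row_j gamma j) in
   (exists m : nat, N ^+ m = 0) /\
   diag_mx (\row_j gamma j) *m N = N *m diag_mx (\row_j gamma j)) ->
  (* Poincare-Dulac normal form *)
  vf_eq0 (vf_bracket (diag_vf gamma) X) ->
  toric_degree gamma tau ->
  incommensurable rho ->
  toric_decomp gamma rho a ->
  rt_wf Lam ->
  (rt_eq (rt_lie X Lam) (rt_zero C n p q) ->
     forall k : 'I_tau, rt_eq (rt_lie (Zfield a k) Lam) (rt_zero C n p q)) /\
  (forall g : fps C n, rt_eq (rt_lie X Lam) (rt_scale g Lam) ->
     forall k : 'I_tau, exists gk : fps C n,
       rt_eq (rt_lie (Zfield a k) Lam) (rt_scale gk Lam)).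
Proof.
move=> X1 [nilX _] comX _ inc dec wf.
(* The bracket condition in coordinates: the component [X k] has weight [gamma k]. *)
have eigX k : vf_apply (diag_vf gamma) (X k) = fps_cst (gamma k) * X k.
  apply: fpsP => al; apply/eqP; rewrite -subr_eq0 -vf_diag_comp.
  by apply/eqP; apply: (comX k al).
have f0 : Lam.2 != 0 by case: wf => al /eqP fal; apply/eqP => f0; apply: fal; rewrite f0.
have K0g k j : weight_rel rho k (gamma j) (a k j)%:~R.
  by exists (fun i => a i j); split=> //; apply: dec.
split=> [/rt_lie_zero H k|g /(rt_lie_scale _ _ wf) H k].
  apply/rt_lie_zero; apply: tensorP => I J; apply: flt_all => N.
  (* Part (i) is the case [g = 0], [d = 0], with correction term 0. *)
  have := @twist_ratio C n X gamma (fun j => (a k j)%:~R) X1 nilX eigX (weight_rel rho k)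
    (weight_rel0 rho k) (@weight_relD _ _ _ _) (@weight_relN _ _ _ _) (K0g k) 0 0 p q
    Lam.2 Lam.1 f0 _ (weight_rel_fun (k0 := k) inc) _ N 0 _ I J.
  rewrite scale0r add0r; apply.
  - by rewrite mulr0 scale0r.
  - by move=> h Hh; apply: (weight_rel_fun inc Hh); apply: weight_rel0.
  - exact: untwisted_one (weight_rel0 rho k) _.
(* If [g(0)] is a weight, [d] is its [Z_k]-weight, unique by incommensurability; otherwise the
   condition is vacuous and 0 serves. *)
have [d dP] : exists d, forall h, weight_rel rho k (g (@mi0 n)) h -> h = d.
  have [[h Hh]|nH] := pselect (exists h, weight_rel rho k (g (@mi0 n)) h).
    by exists h => h' Hh'; apply: (weight_rel_fun inc Hh' Hh).
  by exists 0 => h Hh; case: nH; exists h.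
have [h Hh] := @twist_lim C n X gamma (fun j => (a k j)%:~R) X1 nilX eigX (weight_rel rho k)
    (weight_rel0 rho k) (@weight_relD _ _ _ _) (@weight_relN _ _ _ _) (K0g k) g d p q
    Lam.2 Lam.1 f0 H (weight_rel_fun (k0 := k) inc) dP.
by exists h; apply/(rt_lie_scale _ _ wf).
Qed.
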